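(* Let $H_0,H_1$ be complex Hilbert spaces and let $C\colon \operatorname{dom}(C)\subseteq H_0\to H_1$ be densely defined and closed with $\operatorname{ran}(C)\subseteq H_1$ closed, such that the embedding $\operatorname{dom}(C)\cap \ker(C)^\bot \hookrightarrow H_0$ is compact. Let $\gamma\in L(H_0)$ with $\operatorname{Re}\gamma\ge0$ be such that there exist a closed subspace $U\subseteq H_0$, a constant $c>0$, and operators $\gamma_U\in L(U)$, $\gamma_{U^\bot}\in L(U^\bot)$ with $\operatorname{Re}\gamma_U\geq c$, $\gamma_{U^\bot}=\gamma_{U^\bot}^*\geq 0$ and $\gamma(x_U+x_{U^\bot})=\gamma_Ux_U+\gamma_{U^\bot}x_{U^\bot}$ for all $x_U\in U$, $x_{U^\bot}\in U^\bot$. Let $$A:=-\begin{pmatrix}\gamma&0\\0&0\end{pmatrix}-\begin{pmatrix}0&-C^*\\ C&0\end{pmatrix},\qquad \operatorname{dom}(A)=\operatorname{dom}(C)\times\operatorname{dom}(C^* )\subseteq H_0\times H_1 .$$ Assume that $\mathrm{i}\lambda-A$ and $\mathrm{i}\lambda-A^*$ are one-to-one for all $\lambda\in\mathbb{R}\setminus\{0\}$. Then $A_0:=A|_{\ker(A)^\bot}^{\overline{\operatorname{ran}}(A)}$ generates a strongly stable $C_0$-semigroup.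
   Context: $L(X)$ denotes the bounded linear operators on $X$; $\operatorname{Re}\gamma:=\frac12(\gamma+\gamma^* )$. $\operatorname{dom}(C)$ carries the graph norm. $A_0=A|_{\ker(A)^\bot}^{\overline{\operatorname{ran}}(A)}$ is the operator $A$ with domain restricted to $\operatorname{dom}(A)\cap\ker(A)^\bot$ and codomain $\overline{\operatorname{ran}}(A)$ (the closure of the range of $A$), considered as an operator in the Hilbert space $\overline{\operatorname{ran}}(A)$. A $C_0$-semigroup $T$ on a Hilbert space $X$ is strongly stable if $\lim_{t\to\infty}\|T(t)x\|=0$ for all $x\in X$. *)

(* Defs.v *)
(* The complex numbers are R[i] for R : realType. *)
From HB Require Import structures.
From mathcomp Require Import all_boot all_order all_algebra.
From mathcomp Require Import complex.
From mathcomp Require Import all_classical all_reals all_analysis.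
From mathcomp Require Import ring.

Set Implicit Arguments.
Unset Strict Implicit.
Unset Printing Implicit Defensive.

Import Order.TTheory GRing.Theory Num.Theory.
Import numFieldNormedType.Exports.

Local Open Scope classical_set_scope.
Local Open Scope ring_scope.
Local Open Scope complex_scope.

HB.mixin Record isInnerProduct (R : realType) V & NormedModule R[i] V := {
  dotform : {dot V for (@Num.conj R[i])} ;
  dotform_norm : forall x : V, dotform x x = `|x| ^+ 2
}.

#[short(type="hilbertType")]
HB.structure Definition Hilbert (R : realType) :=
  { V of CompleteNormedModule R[i] V & isInnerProduct R V }.

(* Linear in the first argument, conjugate-linear in the second. *)
Notation "''[' x , y ]" := (dotform x y)
  (format "''[' x ,  y ]") : ring_scope.


Section Minkowski2.
Variable K : numClosedFieldType.

Definition norm2 (a b : K) : K := sqrtC (a ^+ 2 + b ^+ 2).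

Lemma norm2_ge0 a b : 0 <= a -> 0 <= b -> 0 <= norm2 a b.
Proof. by move=> a0 b0; rewrite sqrtC_ge0 addr_ge0 ?exprn_ge0. Qed.

Lemma norm2_ge_l a b : 0 <= a -> 0 <= b -> a <= norm2 a b.
Proof.
move=> a0 b0; rewrite -(@ler_pXn2r _ 2) ?nnegrE ?norm2_ge0//.
by rewrite sqrtCK lerDl exprn_ge0.
Qed.

Lemma norm2_ge_r a b : 0 <= a -> 0 <= b -> b <= norm2 a b.
Proof. by rewrite /norm2 addrC => a0 b0; exact: norm2_ge_l. Qed.

Lemma norm2_le_add a b : 0 <= a -> 0 <= b -> norm2 a b <= a + b.
Proof.
move=> a0 b0; rewrite -(@ler_pXn2r _ 2) ?nnegrE ?norm2_ge0 ?addr_ge0//.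
rewrite sqrtCK sqrrD addrAC lerDl mulrn_wge0//.
by rewrite mulr_ge0.
Qed.

Lemma norm2_le a b c d : 0 <= a -> 0 <= b -> a <= c -> b <= d ->
  norm2 a b <= norm2 c d.
Proof.
move=> a0 b0 ac bd; have c0 := le_trans a0 ac; have d0 := le_trans b0 bd.
by rewrite ler_sqrtC ?nnegrE ?addr_ge0 ?exprn_ge0// lerD// ler_pXn2r.
Qed.

Lemma norm2D a b c d : 0 <= a -> 0 <= b -> 0 <= c -> 0 <= d ->
  norm2 (a + c) (b + d) <= norm2 a b + norm2 c d.
Proof.
move=> a0 b0 c0 d0; have s0 := norm2_ge0 a0 b0; have t0 := norm2_ge0 c0 d0.
rewrite -(@ler_pXn2r _ 2) ?nnegrE ?norm2_ge0 ?addr_ge0//.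
have st : a * c + b * d <= norm2 a b * norm2 c d.
  rewrite -(@ler_pXn2r _ 2) ?nnegrE ?addr_ge0 ?mulr_ge0//.
  rewrite exprMn !sqrtCK -subr_ge0.
  rewrite (_ : _ - _ = (a * d - b * c) ^+ 2); last by ring.
  by rewrite real_exprn_even_ge0// rpredB// ?rpredM// ger0_real.
rewrite sqrrD !sqrtCK.
rewrite (_ : _ + _ = a ^+ 2 + b ^+ 2 + (a * c + b * d) *+ 2 + (c ^+ 2 + d ^+ 2)); last by ring.
by rewrite lerD2r lerD2l lerMn2r st orbT.
Qed.

End Minkowski2.

Section HilbertProduct.
Variables (R : realType) (E F : hilbertType R).

(* The library's norm on E * F is the max norm, hence the alias. *)
Definition hprod : Type := (E * F)%type.

HB.instance Definition _ := GRing.Lmodule.copy hprod (E * F)%type.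

Definition hprod_norm (u : hprod) : R[i] := norm2 `|u.1| `|u.2|.

Let hprod_normD (u v : hprod) :
  hprod_norm (u + v) <= hprod_norm u + hprod_norm v.
Proof.
apply: le_trans (norm2D _ _ _ _) => //.
by apply: norm2_le => //; exact: ler_normD.
Qed.

Let hprod_normZ (l : R[i]) (u : hprod) : hprod_norm (l *: u) = `|l| * hprod_norm u.
Proof.
rewrite /hprod_norm /norm2 !normrZ !exprMn -mulrDr.
by rewrite sqrtCM ?nnegrE ?addr_ge0 ?exprn_ge0// sqrCK.
Qed.

Let hprod_norm0_eq0 (u : hprod) : hprod_norm u = 0 -> u = 0.
Proof.
move=> u0; case: u u0 => x y u0; congr pair; apply/normr0_eq0/le_anti.
  by rewrite normr_ge0 andbT -u0 norm2_ge_l.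
by rewrite normr_ge0 andbT -u0 norm2_ge_r.
Qed.

HB.instance Definition _ := @Lmodule_isNormed.Build R[i] hprod hprod_norm
  hprod_normD hprod_normZ hprod_norm0_eq0.

Lemma hprod_normE (u : hprod) : `|u| = norm2 `|u.1| `|u.2|.
Proof. by []. Qed.

Let hprod_complete (G : set_system hprod) :
  ProperFilter G -> cauchy G -> cvg G.
Proof.
move=> FG /cauchy_ballP Gc.
have c1 : cauchy (fst @ G).
  apply/cauchy_ballP => e /Gc [[A B] /= [GA GB] AB].
  exists ([set x | exists2 u : hprod, A u & u.1 = x],
          [set x | exists2 u : hprod, B u & u.1 = x]) => /=.
    by split; [apply: filterS GA => u Au|apply: filterS GB => u Au]; exists u.
  move=> [x y] /= [[u Au <-] [v Bv <-]]; have := AB (u, v) (conj Au Bv).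
  rewrite -!ball_normE /=; apply: le_lt_trans.
  by apply: (norm2_ge_l (a := `|u.1 - v.1|) (b := `|u.2 - v.2|)).
have c2 : cauchy (snd @ G).
  apply/cauchy_ballP => e /Gc [[A B] /= [GA GB] AB].
  exists ([set x | exists2 u : hprod, A u & u.2 = x],
          [set x | exists2 u : hprod, B u & u.2 = x]) => /=.
    by split; [apply: filterS GA => u Au|apply: filterS GB => u Au]; exists u.
  move=> [x y] /= [[u Au <-] [v Bv <-]]; have := AB (u, v) (conj Au Bv).
  rewrite -!ball_normE /=; apply: le_lt_trans.
  by apply: (norm2_ge_r (a := `|u.1 - v.1|) (b := `|u.2 - v.2|)).
have /cvg_ex[x /cvgrPdist_lt Gx] : cvg (fst @ G) by exact: cauchy_cvg.
have /cvg_ex[y /cvgrPdist_lt Gy] : cvg (snd @ G) by exact: cauchy_cvg.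
apply/cvg_ex; exists ((x, y) : hprod); apply/cvgrPdist_lt => e e0.
have e20 : 0 < e / 2 by rewrite divr_gt0.
have Gx2 : \forall u \near G, `|x - (u : hprod).1| < e / 2 by exact: (Gx _ e20).
have Gy2 : \forall u \near G, `|y - (u : hprod).2| < e / 2 by exact: (Gy _ e20).
apply: filterS2 Gx2 Gy2 => u ux uy.
rewrite [e]splitr; apply: le_lt_trans (ltrD ux uy).
exact: norm2_le_add.
Qed.

HB.instance Definition _ := Uniform_isComplete.Build hprod hprod_complete.

Definition hprod_dot (u v : hprod) : R[i] := '[u.1, v.1] + '[u.2, v.2].

Let hprod_dot_bilinear : bilinear_for *%R (@Num.conj R[i] \; *%R) hprod_dot.
Proof.
split=> [v a u w|u a v w]; rewrite /hprod_dot /=.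
  by rewrite !linearPl /=; ring.
by rewrite !linearPr /=; ring.
Qed.

HB.instance Definition _ := @bilinear_isBilinear.Build R[i] hprod hprod R[i]
  *%R (@Num.conj R[i] \; *%R) hprod_dot hprod_dot_bilinear.

Let hprod_dotC (u v : hprod) :
  hprod_dot u v = (-1) ^+ false * Num.conj (hprod_dot v u).
Proof.
rewrite /hprod_dot rmorphD mulrDr /=.
by rewrite -!(@hermC _ false (@Num.conj R[i])).
Qed.

HB.instance Definition _ := @isHermitianSesquilinear.Build R[i] hprod
  false (@Num.conj R[i]) hprod_dot hprod_dotC.

Let hprod_dot_norm (u : hprod) : hprod_dot u u = `|u| ^+ 2.
Proof. by rewrite /hprod_dot !dotform_norm hprod_normE sqrtCK. Qed.

Let hprod_dot_gt0 (u : hprod) : u != 0 -> 0 < hprod_dot u u.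
Proof. by move=> u0; rewrite hprod_dot_norm exprn_gt0// normr_gt0. Qed.

HB.instance Definition _ :=
  @isDotProduct.Build R[i] hprod hprod_dot hprod_dot_gt0.

HB.instance Definition _ := @isInnerProduct.Build R hprod
  (hprod_dot : {dot hprod for (@Num.conj R[i])}) hprod_dot_norm.

Lemma hprod_dotE (u v : hprod) : '[u, v] = '[u.1, v.1] + '[u.2, v.2].
Proof. by []. Qed.

End HilbertProduct.

Section Operators.
Variable R : realType.
Implicit Types E F : hilbertType R.

(* The norm as an element of R rather than of R[i]. *)
Definition hnorm E (x : E) : R := complex.Re `|x|.

Definition subspace_set E (V : set E) :=
  V 0 /\ forall (a : R[i]) x y, V x -> V y -> V (a *: x + y).

Definition orthocompl E (S : set E) : set E :=
  [set x | forall y, S y -> '[x, y] = 0].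

(* A partial operator: the values of opfun outside opdom are irrelevant. *)
Record operator E F := Operator { opdom : set E ; opfun :> E -> F }.

Section OperatorNotions.
Variables (E F : hilbertType R) (C : operator E F).

Definition linear_operator :=
  subspace_set (opdom C) /\
  forall (a : R[i]) x y, opdom C x -> opdom C y ->
    C (a *: x + y) = a *: C x + C y.

Definition op_graph : set (E * F) := [set p | opdom C p.1 /\ C p.1 = p.2].

Definition op_ran : set F := C @` opdom C.

Definition op_ker : set E := [set x | opdom C x /\ C x = 0].

Definition graph_norm (x : E) : R := Num.sqrt (hnorm x ^+ 2 + hnorm (C x) ^+ 2).

(* The adjoint of C as an operator from V to W, for subspaces V of E containing
   opdom C and W of F containing the range of C. *)
Definition adjoint_in (V : set E) (W : set F) : operator F E :=
  let adj y := [set z | V z /\ forall x, opdom C x -> '[C x, y] = '[x, z]] in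
  Operator [set y | W y /\ adj y !=set0] (fun y => xget 0 (adj y)).

Definition op_adjoint : operator F E := adjoint_in setT setT.

End OperatorNotions.

(* The inclusion of V into E is compact when V carries the norm N. *)
Definition compact_embedding E (V : set E) (N : E -> R) :=
  forall B : set E, B `<=` V -> (exists M : R, forall x, B x -> N x <= M) ->
    precompact B.

(* f restricts to an element of L(V) *)
Definition bounded_on E (V : set E) (f : E -> E) :=
  [/\ forall x, V x -> V (f x),
      forall (a : R[i]) x y, V x -> V y -> f (a *: x + y) = a *: f x + f y
    & exists M : R, forall x, V x -> hnorm (f x) <= M * hnorm x].

(* For f in L(V): the adjoint and the real part in L(V). *)
Definition adjoint_on E (V : set E) (f : E -> E) : E -> E :=
  adjoint_in (Operator V f) V V.

Definition re_on E (V : set E) (f : E -> E) : E -> E :=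
  fun x => 2^-1 *: (f x + adjoint_on V f x).

(* For the order of R[i], so '[f x, x] is real. *)
Definition ge_on E (V : set E) (f : E -> E) (c : R) :=
  forall x, V x -> c%:C * '[x, x] <= '[f x, x].

(* A C_0-semigroup on the Hilbert space V, a closed subspace of E; only the
   restrictions to V of the T t with 0 <= t matter. *)
Definition C0_semigroup E (V : set E) (T : R -> E -> E) :=
  [/\ forall t, 0 <= t -> bounded_on V (T t),
      forall x, V x -> T 0 x = x,
      forall s t x, 0 <= s -> 0 <= t -> V x -> T (s + t) x = T s (T t x)
    & forall x, V x -> T t x @[t --> 0^'+] --> x].

Definition generator_graph E (V : set E) (T : R -> E -> E) : set (E * E) :=
  [set p | V p.1 /\ (t^-1)%:C *: (T t p.1 - p.1) @[t --> 0^'+] --> p.2].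

Definition generates E (V : set E) (B : operator E E) (T : R -> E -> E) :=
  C0_semigroup V T /\ op_graph B = generator_graph V T.

Definition strongly_stable E (V : set E) (T : R -> E -> E) :=
  forall x, V x -> hnorm (T t x) @[t --> +oo] --> 0.

(* A|_{ker(A)^\bot}, to be considered in closure (op_ran A) *)
Definition restrict_ker_orthocompl E (A : operator E E) : operator E E :=
  Operator (opdom A `&` orthocompl (op_ker A)) A.

(* - (gamma 0 ; 0 0) - (0 -C^* ; C 0) *)
Definition block_operator E F (gamma : E -> E) (C : operator E F) :
    operator (hprod E F) (hprod E F) :=
  Operator [set u : hprod E F | opdom C u.1 /\ opdom (op_adjoint C) u.2]
    (fun u => - ((gamma u.1, 0) : hprod E F)
              - ((- op_adjoint C u.2, C u.1) : hprod E F)).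

End Operators.

(* Main.v *)
Require Import Defs.
From mathcomp Require Import all_boot all_order all_algebra.
From mathcomp Require Import complex.
From mathcomp Require Import all_classical all_reals all_analysis.
From mathcomp Require Import ring lra.

(** The idea is an energy argument in the style of LaSalle, made rigorous by the
    compactness of a part of the resolvent.

    The splitting of [gamma] enters through one estimate only, [sectorial]:
    [|gamma x|^2 <= K Re <gamma x, x>]. It makes [A] dissipative, with
    [Re <A (u, v), (u, v)> = - Re <gamma u, u>], and it turns a vanishing
    dissipation into a vanishing damping force. As [C] is closed and densely
    defined, [1 - hA] is onto for all [h > 0] ([block_mdissipative]), so [A]
    generates a contraction semigroup [T] on the whole product space. It is built
    here as the limit of the implicit Euler scheme with dyadic steps; the error of
    the scheme is summable on the domain of [A^2], and all properties of [T] follow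
    from discrete estimates. For a maximal dissipative operator the kernel is the
    orthogonal complement of the range ([ker_ortho_ran]), hence the closure of the
    range is the orthogonal complement of the kernel. This space is invariant, and
    the restriction of [T] to it is generated by [A_0].

    Stability need only be shown for the dense set of initial values [A x] with [x]
    in the domain of [A^3]. Write [(u, v)] for the orbit of [x], so that the orbit of
    [A x] is [(C^* v - gamma u, - C u)]. For smooth initial values the dissipation
    tends to zero in time ([dissipation_cvg0]), hence so does [gamma u]. On the kernel
    of [C], where no compactness is available, the orbit of [A x] is the projection
    of [- gamma u] and therefore tends to zero. On the complement of the kernel the
    compact embedding applies, and it passes to the second component through
    [|C u|^2 = <u, C^* C u>]. Thus every sequence of times tending to infinity has a
    subsequence along which the orbit of [A x] converges ([orbit_subseq]), and the
    limit [p] is orthogonal to the kernel of [C] in its first component and is not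
    damped. The same holds for all [J^k p] with [J = (1 - A)^-1].

    Such limits form a closed [J]-invariant space on which [A] is skew and [J]
    compact ([conserved]). If it were nontrivial, [J] would have an eigenvector in
    it: a vector maximising [|J p| / |p|] satisfies [J^2 r - 2 mu J r + mu r = 0]
    ([maximizer_quadratic]), and a linear factor of this equation gives an
    eigenvalue [i l] of [A]. This contradicts the injectivity of [i l - A] if
    [l <> 0], and the orthogonality to the kernel if [l = 0]. Hence [p = 0], and the
    decreasing energy tends to zero. *)

Set Implicit Arguments.
Unset Strict Implicit.
Unset Printing Implicit Defensive.

Import Order.TTheory GRing.Theory Num.Theory.
Import numFieldNormedType.Exports.

Local Open Scope classical_set_scope.
Local Open Scope ring_scope.
Local Open Scope complex_scope.

(** * The real part of the inner product *)

Section RealInner.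
Variables (R : realType) (E : hilbertType R).
Implicit Types (x y z : E) (a : R).

(** Ordered-field reasoning needs real values. No information is lost on complex
    subspaces: the imaginary part of the inner product is recovered from the
    vector ['i *: y], see [Im_dot]. *)
Definition ip x y : R := complex.Re '[x, y].

Lemma hnormE x : `|x| = (hnorm x)%:C.
Proof. by rewrite /hnorm RRe_real// ger0_real. Qed.

Lemma hnorm_ge0 x : 0 <= hnorm x.
Proof. by rewrite -ler0c -hnormE. Qed.

Lemma hnorm0 : hnorm (0 : E) = 0.
Proof. by rewrite /hnorm normr0. Qed.

Lemma hnorm0_eq0 x : hnorm x = 0 -> x = 0.
Proof. by move=> x0; apply/normr0_eq0; rewrite hnormE x0. Qed.

Lemma hnormN x : hnorm (- x) = hnorm x.
Proof. by rewrite /hnorm normrN. Qed.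

Lemma hnormBC x y : hnorm (x - y) = hnorm (y - x).
Proof. by rewrite -hnormN opprB. Qed.

Lemma hnormD x y : hnorm (x + y) <= hnorm x + hnorm y.
Proof. by rewrite -lecR rmorphD/= -!hnormE ler_normD. Qed.

Lemma hnorm_triangle z x y : hnorm (x - y) <= hnorm (x - z) + hnorm (z - y).
Proof. by rewrite -[x - y](subrKA z); exact: hnormD. Qed.

Lemma hnormZ (b : R[i]) x : hnorm (b *: x) = complex.Re `|b| * hnorm x.
Proof.
by rewrite /hnorm normrZ hnormE; case: `|b| (normr_ge0 b) => u v /=; rewrite lecE /= mulr0 subr0.
Qed.

Lemma hnormZr a x : hnorm (a%:C *: x) = `|a| * hnorm x.
Proof. by rewrite hnormZ normc_def /= expr0n addr0 sqrtr_sqr. Qed.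

Lemma dotC x y : '[x, y] = ('[y, x])^*%C.
Proof. by rewrite (@hermC _ false (@Num.conj R[i])) expr0 mul1r. Qed.

Lemma dotDl x y z : '[x + y, z] = '[x, z] + '[y, z].
Proof. by rewrite linearDl. Qed.
Lemma dotDr x y z : '[x, y + z] = '[x, y] + '[x, z].
Proof. by rewrite linearDr. Qed.
Lemma dotZl (b : R[i]) x y : '[b *: x, y] = b * '[x, y].
Proof. by rewrite linearZl_LR. Qed.
Lemma dotZr (b : R[i]) x y : '[x, b *: y] = b^*%C * '[x, y].
Proof. by rewrite linearZr. Qed.
Lemma dot0l x : '[0, x] = 0.
Proof. by rewrite linear0l. Qed.

Lemma ipC x y : ip x y = ip y x.
Proof. by rewrite /ip dotC; case: '[y, x]. Qed.

Lemma ipDl x y z : ip (x + y) z = ip x z + ip y z.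
Proof. by rewrite /ip dotDl raddfD. Qed.

Lemma ipZl a x y : ip (a%:C *: x) y = a * ip x y.
Proof. by rewrite /ip dotZl; case: '[x, y] => u v /=; rewrite mul0r subr0. Qed.

Lemma ipNl x y : ip (- x) y = - ip x y.
Proof. by rewrite -scaleN1r -(rmorph1 (real_complex R)) -rmorphN ipZl mulN1r. Qed.

Lemma ipDr x y z : ip x (y + z) = ip x y + ip x z.
Proof. by rewrite !(ipC x) ipDl. Qed.
Lemma ipZr a x y : ip x (a%:C *: y) = a * ip x y.
Proof. by rewrite !(ipC x) ipZl. Qed.
Lemma ipNr x y : ip x (- y) = - ip x y.
Proof. by rewrite !(ipC x) ipNl. Qed.
Lemma ip0l y : ip 0 y = 0.
Proof. by rewrite /ip dot0l. Qed.
Lemma ip0r y : ip y 0 = 0.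
Proof. by rewrite ipC ip0l. Qed.

Definition ipE := (ipDl, ipDr, ipNl, ipNr, ipZl, ipZr, ip0l, ip0r).

Lemma ipxx x : ip x x = hnorm x ^+ 2.
Proof. by rewrite /ip dotform_norm hnormE -rmorphXn. Qed.

Lemma ip_eq0 x : ip x x = 0 -> x = 0.
Proof. by rewrite ipxx => /eqP; rewrite sqrf_eq0 => /eqP /hnorm0_eq0. Qed.

Lemma hnorm_sqrD x y : hnorm (x + y) ^+ 2 = hnorm x ^+ 2 + 2 * ip x y + hnorm y ^+ 2.
Proof. by rewrite -!ipxx !ipE (ipC y x); ring. Qed.

Lemma hnorm_sqrB x y : hnorm (x - y) ^+ 2 = hnorm x ^+ 2 - 2 * ip x y + hnorm y ^+ 2.
Proof. by rewrite hnorm_sqrD ipNr hnormN mulrN. Qed.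

Lemma Im_dot x y : complex.Im '[x, y] = ip x ('i *: y).
Proof. by rewrite /ip dotZr; case: '[x, y] => u v /=; ring. Qed.

Lemma dot_eq x y (b : R[i]) :
  ip x y = complex.Re b -> ip x ('i *: y) = complex.Im b -> '[x, y] = b.
Proof. by rewrite -Im_dot /ip; case: '[x, y] => u v; case: b => ? ? /= -> ->. Qed.

Lemma ip_le x y : ip x y <= hnorm x * hnorm y.
Proof.
have [y0|y0] := eqVneq (hnorm y) 0.
  by rewrite (hnorm0_eq0 y0) ip0r hnorm0 mulr0.
have yp : 0 < hnorm y by rewrite lt_neqAle eq_sym y0 hnorm_ge0.
have [x0|x0] := eqVneq (hnorm x) 0.
  by rewrite (hnorm0_eq0 x0) ip0l hnorm0 mul0r.
have xp : 0 < hnorm x by rewrite lt_neqAle eq_sym x0 hnorm_ge0.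
have := sqr_ge0 (hnorm ((hnorm y)%:C *: x - (hnorm x)%:C *: y)).
rewrite hnorm_sqrB !hnormZr !ger0_norm ?hnorm_ge0// !ipE.
move=> h; rewrite -(ler_pM2l (mulr_gt0 xp yp)); by nra.
Qed.

Lemma ip_abs_le x y : `|ip x y| <= hnorm x * hnorm y.
Proof. by rewrite ler_norml ip_le andbT lerNl -ipNl -(hnormN x) ip_le. Qed.

End RealInner.

Arguments hnorm_triangle {R E} z x y.
Arguments ip_le {R E} x y.
Arguments ip_abs_le {R E} x y.
Arguments hnormD {R E} x y.
Arguments hnorm_ge0 {R E} x.
(** * Limits and compactness in terms of real-valued norms *)

Section Limits.
Variables (R : realType) (E : hilbertType R).
Implicit Types (x y z l : E).

Lemma cvg_hnormP {T} {F : set_system T} {FF : Filter F} (f : T -> E) l :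
  f @ F --> l <->
  forall e : R, 0 < e -> \forall t \near F, hnorm (f t - l) < e.
Proof.
split=> [/cvgrPdist_lt fl e e0|fl].
  have : 0 < e%:C by rewrite ltcE /= eqxx.
  move=> /fl; apply: filterS => t.
  by rewrite hnormE ltcR hnormBC.
apply/cvgrPdist_lt => e; rewrite ltcE => /andP[/eqP /= e0 e1].
have := fl _ e1; apply: filterS => t; rewrite hnormE hnormBC ltcE /=.
by rewrite e0 eqxx.
Qed.

Lemma cvg_hnorm0P {T} {F : set_system T} {FF : Filter F} (f : T -> E) l :
  f @ F --> l <-> hnorm (f t - l) @[t --> F] --> (0 : R).
Proof.
rewrite cvg_hnormP cvgr0Pnorm_lt.
by split=> h e /h; apply: filterS => t; rewrite ger0_norm// hnorm_ge0.
Qed.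

Lemma cvg_hnorm_le {T} {F : set_system T} {FF : Filter F} (f : T -> E) l (u : T -> R) :
  (\forall t \near F, hnorm (f t - l) <= u t) -> u @ F --> (0 : R) -> f @ F --> l.
Proof.
move=> fu u0; apply/cvg_hnorm0P; apply: (@squeeze_cvgr _ _ _ _ (cst 0) u) => //.
  by apply: filterS fu => t ->; rewrite hnorm_ge0.
exact: cvg_cst.
Qed.

Lemma cvg_hnorm {T} {F : set_system T} {FF : Filter F} (f : T -> E) l :
  f @ F --> l -> hnorm (f t) @[t --> F] --> hnorm l.
Proof.
move=> /cvg_hnormP fl; apply/cvgrPdist_lt => e /fl; apply: filterS => t.
apply: le_lt_trans; rewrite ler_norml.
have := hnormD (f t - l) l; have := hnormD (l - f t) (f t).
by rewrite !subrK (hnormBC l) => h1 h2; apply/andP; split; lra.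
Qed.

Lemma cvg_ip {T} {F : set_system T} {FF : Filter F} (f g : T -> E) x y :
  f @ F --> x -> g @ F --> y -> ip (f t) (g t) @[t --> F] --> ip x y.
Proof.
have polar (a b : E) : ip a b = (hnorm (a + b) ^+ 2 - hnorm (a - b) ^+ 2) / 4.
  by rewrite hnorm_sqrD hnorm_sqrB; field.
move=> fx gy; under eq_fun do rewrite polar.
rewrite polar; apply: cvgMl; apply: cvgB; rewrite !expr2.
  by apply: cvgM; apply: cvg_hnorm; exact: cvgD.
by apply: cvgM; apply: cvg_hnorm; exact: cvgB.
Qed.

Lemma closureP (V : set E) x :
  closure V x <-> forall e : R, 0 < e -> exists2 y, V y & hnorm (x - y) < e.
Proof.
split=> [Vx e e0|Vx B /nbhs_normP[e /= e0 xB]].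
  have : 0 < e%:C by rewrite ltcE /= eqxx.
  move=> ec; have [y [Vy]] := Vx _ (nbhsx_ballx x (e%:C) ec).
  by rewrite -ball_normE /= hnormE ltcR => xy; exists y.
move: e0; rewrite ltcE => /andP[/eqP /= e0 e1].
have [y Vy xy] := Vx _ e1; exists y; split => //; apply: xB => /=.
by rewrite hnormE ltcE /= e0 eqxx.
Qed.

Lemma cauchy_seq_cvg (s : nat -> E) :
  (forall e : R, 0 < e -> exists N, forall m n, (N <= m)%N -> (N <= n)%N ->
     hnorm (s m - s n) < e) -> exists l, s @ \oo --> l.
Proof.
move=> sC; suff : cvg (s @ \oo) by move=> /cvg_ex.
apply: cauchy_cvg; apply/cauchy_ballP => e; rewrite ltcE => /andP[/eqP /= e0 e1].
have [N sN] := sC _ e1.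
exists (s @` [set n | (N <= n)%N], s @` [set n | (N <= n)%N]) => /=.
  by split; exists N => // n Nn; exists n.
move=> [x y] /= [[m Nm <-] [n Nn <-]].
by rewrite -ball_normE /= hnormE ltcE /= e0 eqxx; exact: sN.
Qed.

Lemma cvg_seq_unique (s : nat -> E) x y : s @ \oo --> x -> s @ \oo --> y -> x = y.
Proof. by move=> h1 h2; apply: (cvg_unique _ h1 h2); exact: norm_hausdorff. Qed.

(** Subsequences are given by maps [f] with [n <= f n], which need not be
    monotone: this is all that is required for limits to be inherited, see
    [cvg_reindex], and such maps compose. *)
Lemma precompact_subseq (B : set E) (s : nat -> E) : precompact B ->
  (forall n, B (s n)) ->
  exists (f : nat -> nat) l, (forall n, (n <= f n)%N) /\ s (f n) @[n --> \oo] --> l.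
Proof.
rewrite precompactE => Bc sB.
have [|l [_ sl]] := Bc (s @ \oo) _.
  by exists 0%N => // n _ /=; exact: subset_closure.
have h (n : nat) : exists m, (n <= m)%N /\ hnorm (s m - l) < n.+1%:R^-1.
  have e0 : 0 < (n.+1%:R^-1 : R) by rewrite invr_gt0 ltr0n.
  have ec : 0 < (n.+1%:R^-1 : R)%:C by rewrite ltcE /= eqxx.
  have h1 : (s @ \oo) (s @` [set m | (n <= m)%N]).
    by exists n => // m /= nm; exists m.
  have [y [[m /= nm <-]]] := sl _ _ h1 (nbhsx_ballx l _ ec).
  by rewrite -ball_normE /= hnormE ltcR => sml; exists m; rewrite hnormBC.
have [f fP] := choice h; exists f, l; split => [n|]; first by case: (fP n).
apply: (@cvg_hnorm_le _ _ _ _ _ (fun n => n.+1%:R^-1)); last exact: cvg_harmonic.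
by near=> n; apply: ltW; case: (fP n).
Unshelve. all: by end_near. Qed.

Lemma cvg_reindex {T : Type} (F : set_system T) (s : nat -> T) (f : nat -> nat) :
  (forall n, (n <= f n)%N) -> s @ \oo `=>` F -> (s \o f) @ \oo `=>` F.
Proof.
move=> fn sF A /sF [N _ h]; exists N => // n /= Nn; apply: h => /=.
exact: leq_trans (fn n).
Qed.

End Limits.

(** * Orthogonality and the Riesz representation theorem *)

(** The discriminant argument. With [a = 0] it shows that a first variation
    vanishes, and in general it gives Cauchy-Schwarz inequalities for forms that
    are only positive semidefinite, whence [a] and [c] may vanish. *)
Lemma quad_ge0 (R : realType) (a b c : R) : 0 <= a -> 0 <= c ->
  (forall t : R, 0 <= a + 2 * t * b + t ^+ 2 * c) -> b ^+ 2 <= a * c.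
Proof.
move=> a0 c0 h; have [c_eq|cN] := eqVneq c 0.
  have [b_eq|bN] := eqVneq b 0; first by rewrite b_eq c_eq; lra.
  have := h (- (a + 1) / (2 * b)); rewrite c_eq mulr0 addr0.
  have -> : a + 2 * (- (a + 1) / (2 * b)) * b = -1 by field.
  by lra.
have cp : 0 < c by rewrite lt_neqAle eq_sym cN.
have := h (- b / c).
have -> : a + 2 * (- b / c) * b + (- b / c) ^+ 2 * c = (a * c - b ^+ 2) / c by field.
by rewrite pmulr_lge0 ?invr_gt0// subr_ge0.
Qed.

Section Subspaces.
Variables (R : realType) (E : hilbertType R).
Implicit Types (V S : set E) (x y z : E).

Lemma subspace0 V : subspace_set V -> V 0.
Proof. by case. Qed.

Lemma subspaceD V x y : subspace_set V -> V x -> V y -> V (x + y).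
Proof. by move=> [_ h] Vx Vy; rewrite -[x]scale1r; exact: h. Qed.

Lemma subspaceZ V (a : R[i]) x : subspace_set V -> V x -> V (a *: x).
Proof. by move=> [V0 h] Vx; rewrite -[a *: x]addr0; exact: h. Qed.

Lemma subspaceN V x : subspace_set V -> V x -> V (- x).
Proof. by move=> hV Vx; rewrite -scaleN1r; exact: subspaceZ. Qed.

Lemma subspaceB V x y : subspace_set V -> V x -> V y -> V (x - y).
Proof. by move=> hV Vx Vy; apply: subspaceD => //; exact: subspaceN. Qed.

Lemma seq_closed V (s : nat -> E) x : closed V -> (forall n, V (s n)) ->
  s @ \oo --> x -> V x.
Proof.
move=> cV sV sx; apply: (@closed_cvg _ _ _ _ s V cV _ x sx).
exact: nearW.
Qed.

(** The vector [z] minimises [|x|^2 - 2 phi x] over [V]. By the parallelogram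
    identity a minimising sequence is Cauchy, and the vanishing of the first
    variation at its limit is the representation. Taking [phi] to be the product
    with a fixed vector yields the projection theorem. *)
Lemma riesz V (phi : E -> R) : subspace_set V -> closed V ->
  (forall x y, V x -> V y -> phi (x + y) = phi x + phi y) ->
  (forall (a : R) x, V x -> phi (a%:C *: x) = a * phi x) ->
  (exists M : R, forall x, V x -> `|phi x| <= M * hnorm x) ->
  exists2 z, V z & forall x, V x -> phi x = ip x z.
Proof.
move=> sV cV phiD phiZ [M phiM].
pose f x := hnorm x ^+ 2 - 2 * phi x.
have f_line x y t : V x -> V y ->
    f (x + t%:C *: y) = f x + 2 * t * (ip x y - phi y) + t ^+ 2 * hnorm y ^+ 2.
  move=> Vx Vy; rewrite /f hnorm_sqrD phiD//; last exact: subspaceZ.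
  by rewrite phiZ// ipZr hnormZr exprMn real_normK ?num_real//; ring.
pose F := f @` V.
have Finf : has_inf F.
  split; first by exists (f 0); exists 0 => //; exact: subspace0.
  exists (- M ^+ 2) => _ [x Vx <-]; rewrite /f.
  have := phiM _ Vx; rewrite ler_norml => /andP[_ hx].
  by have := sqr_ge0 (hnorm x - M); rewrite sqrrB => hs; lra.
pose m := inf F.
have mle x : V x -> m <= f x.
  by move=> Vx; apply: ge_inf; [case: Finf|exists x].
have ex n : exists x, V x /\ f x < m + harmonic n.
  by have [_ [x Vx <-] h] := inf_adherent (harmonic_gt0 n) Finf; exists x.
have [s sP] := choice ex.
have sV' n : V (s n) by case: (sP n).
have para k n : hnorm (s k - s n) ^+ 2 <= 2 * (harmonic k + harmonic n).
  have Vd : V (s n - s k) by exact: subspaceB.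
  have h1 := f_line _ _ (2^-1) (sV' k) Vd.
  have h2 := f_line _ _ 1 (sV' k) Vd.
  have h3 : V (s k + (2^-1)%:C *: (s n - s k)).
    by apply: subspaceD => //; exact: subspaceZ.
  have h4 := mle _ h3; rewrite h1 in h4.
  rewrite rmorph1 scale1r addrC subrK in h2; clear h1.
  have [_ h5] := sP k; have [_ h6] := sP n.
  rewrite (hnormBC (s k)); move: h2 h4 h5 h6; rewrite /m.
  move: (ip _ _ - _) (hnorm _ ^+ 2) => u v; move: (f (s n)) (f (s k)) (inf F) (harmonic k) (harmonic n); clear.
  move=> a b m c d h1 h2 h3 h4; have h5 : 2^-1 ^+2 = 4^-1 :> R by field.
  rewrite h5 in h2. lra.
have [|z sz] := cauchy_seq_cvg (s := s).
  move=> e e0; have e2 : 0 < e ^+ 2 / 4 by rewrite divr_gt0 ?exprn_gt0.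
  have /cvgrPdist_lt /(_ _ e2) [N _ hN] := @cvg_harmonic R.
  have hN' n : (N <= n)%N -> @harmonic R n < e ^+ 2 / 4.
    by move=> /hN /=; rewrite sub0r normrN ger0_norm// ltW// harmonic_gt0.
  exists N => k n Nk Nn; rewrite -(@ltr_pXn2r _ 2) ?nnegrE ?hnorm_ge0 ?(ltW e0)//.
  have h1 := para k n; have h2 := hN' _ Nk; have h3 := hN' _ Nn. lra.
have Vz : V z by exact: seq_closed sz.
exists z => // x Vx; apply/eqP; rewrite eq_sym -subr_eq0 -sqrf_eq0 eq_le sqr_ge0 andbT.
rewrite -[leRHS](mul0r (hnorm x ^+ 2)).
apply: quad_ge0 => //; first exact: sqr_ge0.
move=> t; rewrite add0r (ipC x).
have h1 : (harmonic n + 2 * t * (ip (s n) x - phi x) + t ^+ 2 * hnorm x ^+ 2 : R)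
   @[n --> \oo] --> 0 + 2 * t * (ip z x - phi x) + t ^+ 2 * hnorm x ^+ 2.
  apply: cvgD; last exact: cvg_cst.
  apply: cvgD; first exact: cvg_harmonic.
  apply: cvgMr; apply: cvgB; last exact: cvg_cst.
  by apply: cvg_ip => //; exact: cvg_cst.
rewrite -[X in _ <= X + _]add0r; apply: (cvgr_to_ge h1).
near=> n; have Vx' : V (t%:C *: x) by exact: subspaceZ.
have h2 := mle _ (subspaceD sV (sV' n) Vx'); rewrite f_line// in h2.
have [_ h3] := sP n; lra.
Unshelve. all: by end_near. Qed.

(** Since [V] is complex, orthogonality for the real part suffices. *)
Lemma orthoP V x : subspace_set V ->
  orthocompl V x <-> forall y, V y -> ip x y = 0.
Proof.
move=> sV; split=> [h y /h|h y Vy]; first by rewrite /ip => ->.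
by apply: dot_eq; rewrite h//; exact: subspaceZ.
Qed.

Lemma ortho_sym V x y : orthocompl V x -> V y -> '[y, x] = 0.
Proof. by move=> h Vy; rewrite dotC h// conjc0. Qed.

Lemma ortho_ip V x y : orthocompl V x -> V y -> ip x y = 0.
Proof. by move=> h Vy; rewrite /ip h. Qed.

Lemma ortho_ipr V x y : orthocompl V x -> V y -> ip y x = 0.
Proof. by move=> h Vy; rewrite ipC (ortho_ip h). Qed.

Lemma subspace_ortho S : subspace_set (orthocompl S).
Proof.
split=> [y _|a x y hx hy z Sz]; first by rewrite dot0l.
by rewrite dotDl dotZl hx// hy// mulr0 addr0.
Qed.

Lemma cvg_dot0 S (s : nat -> E) x : s @ \oo --> x ->
  (forall n, orthocompl S (s n)) -> orthocompl S x.
Proof.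
move=> sx hs y Sy; apply: dot_eq => /=.
  apply: (cvg_unique _ (cvg_ip sx (cvg_cst y))); first exact: norm_hausdorff.
  rewrite (_ : (fun n => _) = cst 0); first exact: cvg_cst.
  by apply/funext => n /=; rewrite /ip hs.
apply: (cvg_unique _ (cvg_ip sx (cvg_cst ('i *: y)))); first exact: norm_hausdorff.
rewrite (_ : (fun n => _) = cst 0); first exact: cvg_cst.
by apply/funext => n /=; rewrite -Im_dot hs.
Qed.

Lemma closure_seq V x : closure V x ->
  exists2 s : nat -> E, (forall n, V (s n)) & s @ \oo --> x.
Proof.
move=> /closureP h.
have /choice[s sP] (n : nat) : exists y, V y /\ hnorm (x - y) < n.+1%:R^-1.
  by have [|y] := h n.+1%:R^-1; [rewrite invr_gt0|exists y].
exists s; first by move=> n; case: (sP n).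
apply: (@cvg_hnorm_le _ _ _ _ _ _ _ (fun n => n.+1%:R^-1)); last exact: cvg_harmonic.
by near=> n; rewrite hnormBC ltW//; case: (sP n).
Unshelve. all: by end_near. Qed.

Lemma closed_ortho S : closed (orthocompl S).
Proof.
move=> x /closure_seq[s hs sx]; exact: cvg_dot0 hs.
Qed.

Lemma projection V x : subspace_set V -> closed V ->
  exists2 z, V z & orthocompl V (x - z).
Proof.
move=> sV cV; have [|||z Vz zP] := @riesz V (fun y => ip y x) sV cV.
- by move=> y z _ _; rewrite ipDl.
- by move=> a y _; rewrite ipZl.
- by exists (hnorm x) => y _; rewrite mulrC ip_abs_le.
exists z => //; apply/orthoP => // y Vy.
by rewrite ipC ipDr ipNr zP// subrr.
Qed.

Lemma ortho_ortho V : subspace_set V -> closed V ->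
  orthocompl (orthocompl V) `<=` V.
Proof.
move=> sV cV x hx; have [z Vz xz] := projection x sV cV.
suff -> : x = z by [].
apply/eqP; rewrite -subr_eq0; apply/eqP/ip_eq0.
by rewrite ipDl ipNl (ortho_ip hx)// (ortho_ipr xz)// subr0.
Qed.

Lemma subspace_closure V : subspace_set V -> subspace_set (closure V).
Proof.
move=> sV; split; first by apply: subset_closure; exact: subspace0.
move=> a x y /closure_seq[s hs sx] /closure_seq[r hr ry].
have h : (a *: s n + r n) @[n --> \oo] --> a *: x + y.
  by apply: cvgD => //; exact: cvgZr.
apply: (seq_closed (@closed_closure _ _) _ h) => n.
by apply: subset_closure; case: sV => _; exact.
Qed.

Lemma ortho_closure V : subspace_set V ->
  closure V = orthocompl (orthocompl V).
Proof.
move=> sV; apply/seteqP; split => x hx.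
  case: (closure_seq hx) => s hs sx.
  by apply: (cvg_dot0 sx) => n y hy; rewrite (ortho_sym hy).
apply: ortho_ortho => //.
- exact: subspace_closure.
- exact: closed_closure.
- by move=> y hy; apply: hx => z Vz; apply: hy; exact: subset_closure.
Qed.

(** The usual density criterion: ranges and domains are shown to be dense by
    testing against an orthogonal vector. *)
Lemma ortho_trivial_dense V : subspace_set V ->
  (forall x, (forall y, V y -> ip x y = 0) -> x = 0) -> forall x, closure V x.
Proof.
move=> sV h x; rewrite ortho_closure// => y /orthoP -/(_ sV)/h ->.
by rewrite dotC dot0l conjc0.
Qed.

(** The adjoint in [L(V)] is defined by choice among the vectors representing a
    functional, so that its defining property rests on the existence of such a
    vector, which is the Riesz theorem on [V]. *)
Lemma adjoint_on_dot V f : subspace_set V -> closed V -> bounded_on V f ->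
  forall y, V y -> V (adjoint_on V f y) /\
    forall x, V x -> '[f x, y] = '[x, adjoint_on V f y].
Proof.
move=> sV cV [fV flin [M fM]] y Vy.
have fD x z : V x -> V z -> f (x + z) = f x + f z.
  by move=> Vx Vz; have := flin 1 x z Vx Vz; rewrite !scale1r.
have f0 : f 0 = 0.
  have V0 := subspace0 sV.
  by apply: (addrI (f 0)); rewrite -fD// !addr0.
have fZ (a : R[i]) x : V x -> f (a *: x) = a *: f x.
  move=> Vx; have := flin a x 0 Vx (subspace0 sV).
  by rewrite f0 !addr0.
have [|||z Vz zP] := @riesz V (fun x => ip (f x) y) sV cV.
- by move=> x z Vx Vz; rewrite fD// ipDl.
- by move=> a x Vx; rewrite fZ// ipZl.
- exists (M * hnorm y) => x Vx; apply: le_trans (ip_abs_le _ _) _.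
  by rewrite mulrAC ler_wpM2r ?hnorm_ge0// fM.
have zE x : V x -> '[f x, y] = '[x, z].
  move=> Vx; apply: dot_eq; first exact: zP.
  have -> : complex.Im '[x, z] = complex.Re (- 'i * '[x, z]).
    by case: '[x, z] => u v /=; ring.
  rewrite -dotZl -/(ip _ _) -zP; last exact: subspaceZ.
  rewrite fZ// /ip dotZl dotZr; case: '[f x, y] => u v /=; ring.
by apply: (@xgetPex _ 0 [set z | V z /\ forall x, V x -> '[f x, y] = '[x, z]]); exists z.
Qed.

End Subspaces.

(** * Maximal dissipative operators and their resolvents *)

Section LinearOperators.
Variables (R : realType) (E F : hilbertType R) (C : operator E F).
Hypothesis C_linear : linear_operator C.

Let sC : subspace_set (opdom C) := C_linear.1.

Lemma linopD x y : opdom C x -> opdom C y -> C (x + y) = C x + C y.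
Proof. by move=> dx dy; have := C_linear.2 1 x y dx dy; rewrite !scale1r. Qed.

Lemma linop0 : C 0 = 0.
Proof.
by have d0 := subspace0 sC; apply: (addrI (C 0)); rewrite -linopD// !addr0.
Qed.

Lemma linopZ (a : R[i]) x : opdom C x -> C (a *: x) = a *: C x.
Proof.
move=> dx; have := C_linear.2 a x 0 dx (subspace0 sC).
by rewrite linop0 !addr0.
Qed.

Lemma linopB x y : opdom C x -> opdom C y -> C (x - y) = C x - C y.
Proof.
by move=> dx dy; rewrite -scaleN1r linopD ?linopZ ?scaleN1r//; exact: subspaceN.
Qed.

Lemma subspace_ker : subspace_set (op_ker C).
Proof.
split; first by split; [exact: subspace0|exact: linop0].
move=> a x y [dx x0] [dy y0]; split; first exact: sC.2.
by rewrite C_linear.2// x0 y0 scaler0 addr0.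
Qed.

Lemma subspace_ran : subspace_set (op_ran C).
Proof.
split; first by exists 0; [exact: subspace0|exact: linop0].
move=> a _ _ [x dx <-] [y dy <-]; exists (a *: x + y); first exact: sC.2.
by rewrite C_linear.2.
Qed.

End LinearOperators.

Lemma subrACA (V : zmodType) (a b c d : V) : a - b - (c - d) = a - c - (b - d).
Proof. by rewrite !opprB addrACA [X in _ + X]addrC [RHS]addrACA. Qed.

Section Dissipative.
Variables (R : realType) (E : hilbertType R).
Implicit Types (x y z : E) (h k : R).

Definition lin_map (f : E -> E) :=
  forall (a : R[i]) x y, f (a *: x + y) = a *: f x + f y.

Definition contractive (f : E -> E) := forall x, hnorm (f x) <= hnorm x.

Lemma lin_mapD f x y : lin_map f -> f (x + y) = f x + f y.
Proof. by move=> fl; have := fl 1 x y; rewrite !scale1r. Qed.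

Lemma lin_map0 f : lin_map f -> f 0 = 0.
Proof. by move=> fl; have := lin_mapD 0 0 fl; rewrite addr0 => h; apply: (addrI (f 0)); rewrite addr0 -h. Qed.

Lemma lin_mapZ f (a : R[i]) x : lin_map f -> f (a *: x) = a *: f x.
Proof. by move=> fl; have := fl a x 0; rewrite (lin_map0 fl) !addr0. Qed.

Lemma lin_mapN f x : lin_map f -> f (- x) = - f x.
Proof. by move=> fl; rewrite -scaleN1r (lin_mapZ _ _ fl) scaleN1r. Qed.

Lemma lin_mapB f x y : lin_map f -> f (x - y) = f x - f y.
Proof. by move=> fl; rewrite (lin_mapD _ _ fl) (lin_mapN _ fl). Qed.

Lemma contractive_cvg f (s : nat -> E) x : lin_map f -> contractive f ->
  s @ \oo --> x -> f (s n) @[n --> \oo] --> f x.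
Proof.
move=> fl fc /cvg_hnorm0P sx; apply: (cvg_hnorm_le _ sx).
by near=> n; rewrite -lin_mapB.
Unshelve. all: by end_near. Qed.

Lemma iter_lin f n : lin_map f -> lin_map (iter n f).
Proof. by move=> fl; elim: n => // n IH a x y; rewrite !iterS IH fl. Qed.

Lemma iter_contractive f n : contractive f -> contractive (iter n f).
Proof. by move=> fc; elim: n => // n IH x; apply: le_trans (fc _) (IH x). Qed.

Lemma iter_comm (f g : E -> E) n : (forall x, f (g x) = g (f x)) ->
  forall x, f (iter n g x) = iter n g (f x).
Proof. by move=> fg; elim: n => // n IH x; rewrite !iterS fg IH. Qed.

(** Telescoping: each of the [n] replacements of [f] by [g] costs at most the
    defect [f x - g x], as the contractions commute. This is what makes the Euler
    scheme converge. *)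
Lemma iter_diff f g n x : lin_map f -> lin_map g -> contractive f -> contractive g ->
  (forall x, f (g x) = g (f x)) ->
  hnorm (iter n f x - iter n g x) <= n%:R * hnorm (f x - g x).
Proof.
move=> fl gl fc gc fg; elim: n => [|n IH]; first by rewrite subrr hnorm0 mul0r.
apply: le_trans (hnorm_triangle (f (iter n g x)) _ _) _.
rewrite -natr1 mulrDl mul1r; apply: lerD.
  by rewrite !iterS -lin_mapB//; apply: le_trans (fc _) IH.
rewrite iter_comm// iterSr -lin_mapB; last exact: iter_lin.
exact: iter_contractive.
Qed.

(** Dissipativity in the form in which it controls [1 - hA]: the latter is bounded
    below by 1, hence injective, and its inverse is a contraction. *)
Lemma dissipative_le h x y : 0 < h -> ip y x <= 0 -> hnorm x <= hnorm (x - h%:C *: y).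
Proof.
move=> h0 yx; have [x0|x0] := eqVneq (hnorm x) 0; first by rewrite x0 hnorm_ge0.
have xp : 0 < hnorm x by rewrite lt_neqAle eq_sym x0 hnorm_ge0.
rewrite -(ler_pM2r xp); apply: (le_trans _ (ip_le _ _)).
by rewrite -expr2 -ipxx !ipE; nra.
Qed.

Variable A : operator E E.

(** Surjectivity of [1 - hA] for a single [h] implies it for all; asking for all of
    them spares this argument where [A] is concrete enough to treat every [h]. *)
Definition mdissipative := [/\ linear_operator A,
  forall x, opdom A x -> ip (A x) x <= 0 &
  forall h, 0 < h -> forall y, exists2 x, opdom A x & x - h%:C *: A x = y].

(** The range of [1 - hA] is closed because [A] is closed and [1 - hA] is bounded
    below; the last hypothesis says that nothing is orthogonal to it. *)
Lemma mdissipative_closed : linear_operator A ->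
  (forall x, opdom A x -> ip (A x) x <= 0) ->
  (forall (s : nat -> E) x y, (forall n, opdom A (s n)) -> s @ \oo --> x ->
     A (s n) @[n --> \oo] --> y -> opdom A x /\ A x = y) ->
  (forall h q, 0 < h -> (forall x, opdom A x -> ip q (x - h%:C *: A x) = 0) -> q = 0) ->
  mdissipative.
Proof.
move=> linA dA cA oA; split=> // h h0 y; have sA := linA.1.
pose V := [set x - h%:C *: A x | x in opdom A].
have sV : subspace_set V.
  split; first by exists 0; rewrite ?(linop0 linA) ?scaler0 ?subrr//; exact: subspace0.
  move=> a _ _ [x dx <-] [x' dx' <-]; exists (a *: x + x'); first exact: sA.2.
  rewrite linA.2// scalerBr scalerDr opprD [LHS]addrACA; congr (_ - _ + _).
  by rewrite !scalerA mulrC.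
have cV : closed V.
  move=> z /closure_seq[s sVn sz].
  have ex n : exists x, opdom A x /\ x - h%:C *: A x = s n.
    by have [x dx e] := sVn n; exists x.
  have [x xP] := choice ex.
  have [|l xl] := cauchy_seq_cvg (s := x).
    move=> e e0; have e2 : 0 < e / 2 by lra.
    have [N _ hN] := (cvg_hnormP _ _).1 sz _ e2.
    exists N => m n Nm Nn.
    have [dm em] := xP m; have [dn en] := xP n.
    have dmn := subspaceB sA dm dn.
    apply: le_lt_trans (dissipative_le h0 (dA _ dmn)) _.
    rewrite (linopB linA)// scalerBr subrACA em en.
    have h1 := hN _ Nm; have h2 := hN _ Nn; rewrite /= in h1 h2.
    have h3 := hnorm_triangle z (s m) (s n); rewrite (hnormBC z) in h3; lra.
  have Al : A (x n) @[n --> \oo] --> h^-1%:C *: (l - z).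
    have -> : (fun n => A (x n)) = (fun n => h^-1%:C *: (x n - s n)).
      apply/funext => n; have [_ <-] := xP n.
      rewrite opprB addrC subrK scalerA -rmorphM mulVf ?gt_eqF//.
      by rewrite rmorph1 scale1r.
    by apply: cvgZr; exact: cvgB.
  have [dl el] := cA _ _ _ (fun n => (xP n).1) xl Al.
  exists l => //; rewrite el scalerA -rmorphM mulfV ?gt_eqF//.
  by rewrite rmorph1 scale1r opprB addrC subrK.
have [x dx xy] : V y.
  apply: (ortho_ortho sV cV) => q /(orthoP _ sV) hq.
  suff -> : q = 0 by rewrite dotC dot0l conjc0.
  by apply: (oA h) => // x dx; apply: hq; exists x.
by exists x.
Qed.

Definition resolvent h y : E := xget 0 [set x | opdom A x /\ x - h%:C *: A x = y].

Hypothesis mA : mdissipative.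

Let linA : linear_operator A. Proof. by case: mA. Qed.
Let domA : subspace_set (opdom A) := linA.1.
Let opD := linopD linA.
Let op0 := linop0 linA.
Let opZ := linopZ linA.
Let opB := linopB linA.

Lemma dissipative_ip x : opdom A x -> ip (A x) x <= 0.
Proof. by case: mA => _ h _; exact: h. Qed.

Lemma mdissipative_le h x : 0 < h -> opdom A x -> hnorm x <= hnorm (x - h%:C *: A x).
Proof. by move=> h0 dx; apply: dissipative_le => //; exact: dissipative_ip. Qed.

Lemma resolventP h y : 0 < h ->
  opdom A (resolvent h y) /\ resolvent h y - h%:C *: A (resolvent h y) = y.
Proof.
move=> h0; apply: (@xgetPex _ 0 [set x | opdom A x /\ x - h%:C *: A x = y]).
by case: mA => _ _ /(_ h h0 y)[x dx xy]; exists x.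
Qed.

Lemma resolvent_dom h y : 0 < h -> opdom A (resolvent h y).
Proof. by move=> /(resolventP y)[]. Qed.

Lemma resolvent_eq h y : 0 < h -> resolvent h y - h%:C *: A (resolvent h y) = y.
Proof. by move=> /(resolventP y)[]. Qed.

Lemma resolvent_uniq h x : 0 < h -> opdom A x -> resolvent h (x - h%:C *: A x) = x.
Proof.
move=> h0 dx; set y := x - _.
have [dr er] := resolventP y h0.
apply/eqP; rewrite -subr_eq0; apply/eqP/hnorm0_eq0/le_anti.
rewrite hnorm_ge0 andbT; apply: le_trans (mdissipative_le h0 (subspaceB domA dr dx)) _.
by rewrite opB// scalerBr subrACA er subrr hnorm0.
Qed.

Lemma resolvent_contractive h : 0 < h -> contractive (resolvent h).
Proof.
move=> h0 y; have [dr er] := resolventP y h0.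
by rewrite -[in leRHS]er mdissipative_le.
Qed.

Lemma resolvent_lin h : 0 < h -> lin_map (resolvent h).
Proof.
move=> h0 a x y; have [dx ex] := resolventP x h0; have [dy ey] := resolventP y h0.
rewrite -[in LHS]ex -[in LHS]ey.
rewrite -[RHS](resolvent_uniq h0); last by apply: subspaceD => //; exact: subspaceZ.
rewrite opD ?opZ//; last exact: subspaceZ.
congr resolvent; rewrite scalerBr scalerDr opprD [RHS]addrACA; congr (_ - _ + _).
by rewrite !scalerA mulrC.
Qed.

Lemma resolvent_incr h y : 0 < h -> resolvent h y - y = h%:C *: A (resolvent h y).
Proof. by move=> h0; rewrite -[X in _ - X](resolvent_eq y h0) opprB addrC subrK. Qed.

Lemma resolvent_opE h y : 0 < h -> A (resolvent h y) = h^-1%:C *: (resolvent h y - y).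
Proof.
move=> h0; rewrite resolvent_incr// scalerA -rmorphM mulVf ?gt_eqF//.
by rewrite rmorph1 scale1r.
Qed.

(** [A] commutes with its resolvents. The vector [A (resolvent h x)] lies in the
    domain because it is a combination of [x] and [resolvent h x]. *)
Lemma resolvent_op h x : 0 < h -> opdom A x -> A (resolvent h x) = resolvent h (A x).
Proof.
move=> h0 dx; have [dr er] := resolventP x h0.
have dA : opdom A (A (resolvent h x)).
  by rewrite resolvent_opE//; apply: subspaceZ => //; exact: subspaceB.
rewrite -[LHS](resolvent_uniq h0)//; congr resolvent.
by rewrite -opZ// -opB ?er//; exact: subspaceZ.
Qed.

Lemma resolventC h k x : 0 < h -> 0 < k ->
  resolvent h (resolvent k x) = resolvent k (resolvent h x).
Proof.
move=> h0 k0; have [dh eh] := resolventP x h0.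
rewrite -[RHS](resolvent_uniq h0); last exact: resolvent_dom.
congr resolvent; rewrite resolvent_op// -lin_mapZ; last exact: resolvent_lin.
by rewrite -lin_mapB ?eh//; exact: resolvent_lin.
Qed.

Lemma resolvent_sub h x : 0 < h -> opdom A x ->
  resolvent h x = x + h%:C *: resolvent h (A x).
Proof.
by move=> h0 dx; rewrite -resolvent_op// -resolvent_incr// addrC subrK.
Qed.

Lemma resolvent_sub_le h x : 0 < h -> opdom A x ->
  hnorm (resolvent h x - x) <= h * hnorm (A x).
Proof.
move=> h0 dx; rewrite resolvent_incr// resolvent_op// hnormZr gtr0_norm//.
by rewrite ler_pM2l// resolvent_contractive.
Qed.

(** A vector [y] orthogonal to the domain is orthogonal to its own resolvent [r],
    and [y = r - A r] then gives [|r|^2 = Re <A r, r> <= 0]. *)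
Lemma opdom_dense x : closure (opdom A) x.
Proof.
apply: ortho_trivial_dense => // y yA.
have [dr er] := resolventP y ltr01.
have h2 := yA _ dr; rewrite -[X in ip X]er rmorph1 scale1r ipDl ipNl ipxx in h2.
have h1 := dissipative_ip dr.
have h3 : hnorm (resolvent 1 y) ^+ 2 = 0.
  by apply/le_anti; rewrite sqr_ge0 andbT; lra.
have r0 : resolvent 1 y = 0.
  by move/eqP: h3; rewrite sqrf_eq0 => /eqP/hnorm0_eq0.
by rewrite -er r0 op0 scaler0 subrr.
Qed.

Lemma resolvent_cvg x e : 0 < e ->
  exists2 d : R, 0 < d & forall h, 0 < h -> h < d -> hnorm (resolvent h x - x) < e.
Proof.
move=> e0; have e3 : 0 < e / 3 by lra.
have xA : closure (opdom A) x by exact: opdom_dense.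
have [y dy xy] := (closureP _ _).1 xA _ e3.
have Ay1 : 0 < hnorm (A y) + 1 by have := hnorm_ge0 (A y); lra.
exists (e / 3 / (hnorm (A y) + 1)); first by rewrite divr_gt0.
move=> h h0; rewrite ltr_pdivlMr// => hd.
have h1 := resolvent_sub_le h0 dy.
have h2 : hnorm (resolvent h x - resolvent h y) < e / 3.
  rewrite -lin_mapB; last exact: resolvent_lin.
  exact: le_lt_trans (resolvent_contractive _ _) xy.
have h3 := hnorm_triangle (resolvent h y) (resolvent h x) x.
have h4 := hnorm_triangle y (resolvent h y) x.
rewrite hnormBC in xy; nra.
Qed.

(** The domain of the [n]-th power of [A]. *)
Fixpoint opdom_pow n x : Prop :=
  if n is n'.+1 then opdom A x /\ opdom_pow n' (A x) else True.

Lemma opdom_powS n x : opdom_pow n.+1 x -> opdom_pow n x.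
Proof. by elim: n x => // n IH x [dx /IH]. Qed.

Lemma resolvent_opdom_pow n h x : 0 < h -> opdom_pow n x -> opdom_pow n.+1 (resolvent h x).
Proof.
move=> h0; elim: n x => [x _|n IH x [dx dAx]]; first by split => //; exact: resolvent_dom.
by split; [exact: resolvent_dom|rewrite resolvent_op//; exact: IH].
Qed.

Lemma opdom_pow_dense n x e : 0 < e -> exists2 y, opdom_pow n y & hnorm (x - y) < e.
Proof.
elim: n e => [|n IH] e e0; first by exists x; rewrite ?subrr ?hnorm0.
have e2 : 0 < e / 2 by lra.
have [y dy xy] := IH _ e2.
have [d d0 dP] := resolvent_cvg y e2.
have d2 : 0 < d / 2 by lra.
exists (resolvent (d / 2) y); first exact: resolvent_opdom_pow.
have h1 : hnorm (resolvent (d / 2) y - y) < e / 2 by apply: dP => //; lra.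
rewrite hnormBC in h1.
have h2 := hnorm_triangle y x (resolvent (d / 2) y); lra.
Qed.

(** The kernels of a maximal dissipative operator and of its adjoint agree. If [q]
    is orthogonal to the range, then its resolvent [r] satisfies
    [|A r|^2 = Re <r, A r> <= 0], so that [q = r]. Conversely, if [A q = 0], then
    [Re <A (q - s x), q - s x> <= 0] holds for all real [s], and the part of this
    quadratic inequality that is linear in [s] has to vanish. *)
Lemma ker_ortho_ran : orthocompl (op_ran A) = op_ker A.
Proof.
apply/seteqP; split=> q.
  move=> hq; have [dr er] := resolventP q ltr01.
  have h1 : ip q (A (resolvent 1 q)) = 0.
    by apply: (ortho_ip hq); exists (resolvent 1 q).
  have h2 := dissipative_ip dr.
  rewrite rmorph1 scale1r in er.
  have h3 : ip (A (resolvent 1 q)) (A (resolvent 1 q)) <= 0.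
    by move: h1; rewrite -[X in ip X]er ipDl ipNl (ipC (resolvent 1 q)) => h1; lra.
  have A0 : A (resolvent 1 q) = 0.
    apply: ip_eq0; apply/le_anti; rewrite h3 ipxx sqr_ge0//.
  by rewrite -er A0 subr0.
move=> [dq q0]; apply/orthoP; first exact: subspace_ran.
move=> _ [x dx <-]; apply/eqP; rewrite -sqrf_eq0 eq_le sqr_ge0 andbT.
rewrite -[leRHS](mul0r (- (4 * ip (A x) x))); apply: quad_ge0 => //.
  by have := dissipative_ip dx; lra.
move=> t; have dtx : opdom A ((2 * t)%:C *: x) by exact: subspaceZ.
have h := dissipative_ip (subspaceB domA dq dtx).
rewrite opB// q0 sub0r opZ// !ipE (ipC (A x) q) in h; lra.
Qed.

End Dissipative.

(** * The semigroup generated by a maximal dissipative operator *)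

Section DyadicSteps.
Variable R : realType.
Implicit Types (s t : R) (n : nat).

Definition dstep n : R := 2^-1 ^+ n.
(** Rounding the number of steps down makes [nsteps n] additive up to one step, so
    that the semigroup law survives in the limit without any appeal to
    continuity in time. *)
Definition nsteps n t : nat := Num.truncn (t / dstep n).

Lemma dstep_gt0 n : 0 < dstep n.
Proof. by rewrite exprn_gt0. Qed.

Lemma dstepS n : dstep n = 2 * dstep n.+1.
Proof. by rewrite /dstep exprS mulrA divff// mul1r. Qed.

Lemma cvg_dstep : dstep @ \oo --> (0 : R).
Proof. by apply: cvg_expr; rewrite ger0_norm ?invf_lt1 ?ltr1n. Qed.

Lemma nsteps_le n t : 0 <= t -> (nsteps n t)%:R * dstep n <= t.
Proof.
move=> t0; rewrite -ler_pdivlMr ?dstep_gt0// truncn_le.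
by rewrite divr_ge0// ltW// dstep_gt0.
Qed.

Lemma nsteps_gt n t : t < (nsteps n t).+1%:R * dstep n.
Proof. by rewrite -ltr_pdivrMr ?dstep_gt0// truncnS_gt. Qed.

Lemma ltn_steps n (a b : nat) t :
  a%:R * dstep n <= t -> t < b%:R * dstep n -> (a < b)%N.
Proof.
move=> h1 h2; have := le_lt_trans h1 h2.
by rewrite ltr_pM2r ?dstep_gt0// ltr_nat.
Qed.

Lemma nsteps_double n t : 0 <= t ->
  exists2 e : nat, (e <= 1)%N & nsteps n.+1 t = (e + 2 * nsteps n t)%N.
Proof.
move=> t0; have h1 := nsteps_le n t0; have h2 := nsteps_gt n t.
have h3 := nsteps_le n.+1 t0; have h4 := nsteps_gt n.+1 t.
rewrite dstepS mulrA -natrM in h1; rewrite dstepS mulrA -natrM in h2.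
have a1 := ltn_steps h1 h4; have a2 := ltn_steps h3 h2.
exists (nsteps n.+1 t - 2 * nsteps n t)%N; last by rewrite subnK// mulnC -ltnS.
rewrite leq_subLR -ltnS; apply: leq_trans a2 _.
by rewrite mulnC mulnS addnC addn2 addn1.
Qed.

Lemma nsteps_add n s t : 0 <= s -> 0 <= t ->
  exists2 e : nat, (e <= 1)%N & nsteps n (s + t) = (e + (nsteps n s + nsteps n t))%N.
Proof.
move=> s0 t0; have h1 := nsteps_le n s0; have h2 := nsteps_gt n s.
have h3 := nsteps_le n t0; have h4 := nsteps_gt n t.
have h5 := nsteps_le n (addr_ge0 s0 t0); have h6 := nsteps_gt n (s + t).
have h7 : (nsteps n s + nsteps n t)%:R * dstep n <= s + t.
  by rewrite natrD mulrDl lerD.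
have h8 : s + t < ((nsteps n s).+1 + (nsteps n t).+1)%:R * dstep n.
  by rewrite natrD mulrDl ltrD.
have a1 := ltn_steps h7 h6; have a2 := ltn_steps h5 h8.
exists (nsteps n (s + t) - (nsteps n s + nsteps n t))%N; last by rewrite subnK// -ltnS.
by rewrite leq_subLR -ltnS; move: a2; rewrite addSn addnS addn1.
Qed.

Lemma nsteps0 n : nsteps n 0 = 0%N.
Proof. by rewrite /nsteps mul0r truncn0. Qed.

Lemma nsteps_cvg t : 0 <= t -> (nsteps n t)%:R * dstep n @[n --> \oo] --> t.
Proof.
move=> t0; apply: (@squeeze_cvgr _ _ _ _ (fun n => t - dstep n) (cst t)).
- apply: nearW => n /=; rewrite nsteps_le// andbT.
  by have := nsteps_gt n t; rewrite -natr1 mulrDl mul1r; lra.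
- by rewrite -[X in _ --> X]subr0; apply: cvgB; [exact: cvg_cst|exact: cvg_dstep].
- exact: cvg_cst.
Qed.

End DyadicSteps.

(** Dyadic steps form a geometric sequence, so consecutive differences of order
    [dstep n] are summable. *)
Lemma geometric_cauchy (R : realType) (E : hilbertType R) (s : nat -> E) (K : R) :
  0 <= K -> (forall n, hnorm (s n.+1 - s n) <= K * dstep R n) ->
  forall m n, (n <= m)%N -> hnorm (s m - s n) <= 2 * K * dstep R n.
Proof.
move=> K0 sK m n nm.
suff h k : hnorm (s (k + n)%N - s n) <= 2 * K * (dstep R n - dstep R (k + n)).
  rewrite -(subnK nm); apply: le_trans (h _) _.
  by rewrite ler_wpM2l ?mulr_ge0// gerBl ltW// dstep_gt0.
elim: k => [|k IH]; first by rewrite !subrr hnorm0 mulr0.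
apply: le_trans (hnorm_triangle (s (k + n)%N) _ _) _.
rewrite addSn; have h1 := sK (k + n)%N; have h2 := dstepS R (k + n).
by rewrite h2 in h1 IH; lra.
Qed.

Section Semigroup.
Variables (R : realType) (E : hilbertType R) (A : operator E E).
Hypothesis mA : mdissipative A.
Implicit Types (x y z : E) (h s t : R) (n k : nat).

Let J h := resolvent A h.
Let Jl h (h0 : 0 < h) : lin_map (J h) := resolvent_lin mA h0.
Let Jc h (h0 : 0 < h) : contractive (J h) := resolvent_contractive mA h0.

Lemma iter_opdom k h x : 0 < h -> opdom A x ->
  opdom A (iter k (J h) x) /\ A (iter k (J h) x) = iter k (J h) (A x).
Proof.
move=> h0 dx; elim: k => // k [dk IH]; rewrite !iterS; split.
  exact: resolvent_dom.
by rewrite /J resolvent_op// -/(J h) IH.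
Qed.

Lemma iter_resolvent_sub k h x : 0 < h -> opdom A x ->
  hnorm (iter k (J h) x - x) <= k%:R * h * hnorm (A x).
Proof.
move=> h0 dx; elim: k => [|k IH]; first by rewrite subrr hnorm0 !mul0r.
apply: le_trans (hnorm_triangle (iter k (J h) x) _ _) _.
rewrite -natr1 !mulrDl addrC mul1r; apply: lerD => //.
have [dk ek] := iter_opdom k h0 dx.
apply: le_trans (resolvent_sub_le mA h0 dk) _; rewrite ler_pM2l// ek.
by apply: iter_contractive; exact: Jc.
Qed.

(** One implicit Euler step of length [2h] and two of length [h] agree up to order
    [h^2]: their expansions in powers of [h] differ only from the [A^2] term on. *)
Lemma resolvent_half h x : 0 < h -> opdom_pow A 2 x ->
  hnorm (J (2 * h) x - iter 2 (J h) x) <= 8 * h ^+ 2 * hnorm (A (A x)).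
Proof.
move=> h0 [dx [dAx _]]; have h20 : 0 < 2 * h by lra.
pose w := A (A x).
have e1 (k : R) : 0 < k -> J k x = x + k%:C *: A x + (k ^+ 2)%:C *: J k w.
  move=> k0; rewrite /J (resolvent_sub mA k0 dx) (resolvent_sub mA k0 dAx).
  by rewrite scalerDr scalerA -rmorphM -expr2 addrA.
have e2 : iter 2 (J h) x =
    x + (2 * h)%:C *: A x + ((2 * h ^+ 2)%:C *: J h w + (h ^+ 2)%:C *: J h (J h w)).
  rewrite /= {1}(e1 _ h0) !(lin_mapD _ _ (Jl h0)) !(lin_mapZ _ _ (Jl h0)) e1//.
  rewrite {2}/J (resolvent_sub mA h0 dAx) -/(J h) -/w scalerDr scalerA -rmorphM -expr2.
  rewrite !mulr2n !mulrDl !mul1r !rmorphD /= !scalerDl.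
  by rewrite -!addrA; congr (_ + (_ + _)); rewrite addrCA.
rewrite e1// e2 opprD addrACA subrr add0r.
have b1 : hnorm (J (2 * h) w) <= hnorm w by exact: Jc.
have b2 : hnorm (J h w) <= hnorm w by exact: Jc.
have b3 : hnorm (J h (J h w)) <= hnorm w by apply: le_trans b2; exact: Jc.
apply: le_trans (hnormD _ _) _.
rewrite hnormN; apply: le_trans (lerD (lexx _) (hnormD _ _)) _.
rewrite !hnormZr !ger0_norm ?mulr_ge0 ?sqr_ge0 ?(ltW h0)//.
rewrite -/w exprMn.
have q0 := sqr_ge0 h; have w0 := mulr_ge0 q0 (hnorm_ge0 w).
have c1 := ler_wpM2l q0 b1; have c2 := ler_wpM2l q0 b2; have c3 := ler_wpM2l q0 b3.
by move: (h ^+ 2) q0 w0 c1 c2 c3 => q *; rewrite expr2; lra.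
Qed.

(** The implicit Euler scheme [(1 - hA)^-(t/h)] with [h = dstep n]. *)
Definition euler n t : E -> E := iter (nsteps n t) (J (dstep R n)).

Lemma euler_lin n t : lin_map (euler n t).
Proof. by apply: iter_lin; apply: Jl; exact: dstep_gt0. Qed.

Lemma euler_contractive n t : contractive (euler n t).
Proof. by apply: iter_contractive; apply: Jc; exact: dstep_gt0. Qed.

(** Halving the step changes the approximation by about [t / dstep n] local errors
    of order [dstep n ^ 2], and by at most one additional step due to rounding. *)
Lemma eulerS_sub n t x : 0 <= t -> opdom_pow A 2 x ->
  hnorm (euler n.+1 t x - euler n t x)
    <= (4 * t * hnorm (A (A x)) + hnorm (A x)) * dstep R n.
Proof.
move=> t0 dx; have d0 := dstep_gt0 R n.+1; have d0' := dstep_gt0 R n.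
rewrite /euler; have [e e1 ->] := nsteps_double n t0.
rewrite iterD.
apply: le_trans (hnorm_triangle (iter (2 * nsteps n t) (J (dstep R n.+1)) x) _ _) _.
have dx1 : opdom A x by case: dx.
have [dk ek] := iter_opdom (2 * nsteps n t) d0 dx1.
rewrite addrC mulrDl; apply: lerD; last first.
  apply: le_trans (iter_resolvent_sub _ d0 dk) _.
  have h1 : hnorm (A (iter (2 * nsteps n t) (J (dstep R n.+1)) x)) <= hnorm (A x).
    by rewrite ek; apply: iter_contractive; exact: Jc.
  have h2 : (e%:R : R) <= 1 by rewrite (ler_nat R e 1).
  have h3 : e%:R * dstep R n.+1 <= dstep R n.
    by rewrite (dstepS R n); have := ler0n R e; nra.
  by rewrite mulrC; apply: ler_pM => //; [exact: hnorm_ge0|rewrite mulr_ge0// ltW].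
rewrite mulnC iterM hnormBC.
apply: le_trans (iter_diff _ _ _ _ _ _ _) _.
- exact: Jl.
- by apply: iter_lin; exact: Jl.
- exact: Jc.
- by apply: iter_contractive; exact: Jc.
- by move=> z /=; rewrite /J !(resolventC mA _ d0' d0).
rewrite {1}(dstepS R n).
apply: le_trans (ler_wpM2l _ (resolvent_half d0 dx)) _ => //.
have := nsteps_le n t0; rewrite (dstepS R n).
have := hnorm_ge0 (A (A x)).
move: (hnorm _) (nsteps _ _)%:R (dstep _ _) d0 => a k d dp a0 kd.
have -> : k * (8 * d ^+ 2 * a) = (4 * a * d) * (k * (2 * d)) by ring.
have -> : 4 * t * a * (2 * d) = 8 * a * d * t by ring.
apply: le_trans (ler_wpM2l _ kd) _; first by rewrite !mulr_ge0// ltW.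
have : 0 <= a * d * t by rewrite !mulr_ge0// ltW.
by lra.
Qed.

Lemma euler_cvg t x : 0 <= t -> exists l : E, euler n t x @[n --> \oo] --> l.
Proof.
move=> t0; apply: cauchy_seq_cvg => e e0.
have e4 : 0 < e / 4 by lra.
have [y dy xy] := opdom_pow_dense mA 2 x e4.
pose K := 4 * t * hnorm (A (A y)) + hnorm (A y).
have K0 : 0 <= K by rewrite addr_ge0 ?mulr_ge0 ?hnorm_ge0.
have K1 : 0 < 2 * K + 1 by lra.
have eK : 0 < e / 4 / (2 * K + 1) by rewrite divr_gt0.
have /cvgrPdist_lt/(_ _ eK)[N _ hN] := @cvg_dstep R.
have {}hN : 2 * K * dstep R N < e / 4.
  have := hN N (leqnn _); rewrite /= sub0r normrN ger0_norm ?ltW ?dstep_gt0//.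
  by rewrite ltr_pdivlMr//; have := dstep_gt0 R N; nra.
have yN m : (N <= m)%N -> hnorm (euler m t y - euler N t y) < e / 4.
  move=> Nm; apply: le_lt_trans hN.
  apply: (@geometric_cauchy _ _ (fun n => euler n t y)) => // n.
  exact: eulerS_sub.
have xm m : hnorm (euler m t x - euler m t y) < e / 4.
  by rewrite -lin_mapB; [apply: le_lt_trans xy; exact: euler_contractive|exact: euler_lin].
exists N => m n Nm Nn.
have h1 := hnorm_triangle (euler m t y) (euler m t x) (euler n t x).
have h2 := hnorm_triangle (euler n t y) (euler m t y) (euler n t x).
have h3 := hnorm_triangle (euler N t y) (euler m t y) (euler n t y).
have h4 := xm m; have h5 := xm n; have h6 := yN m Nm; have h7 := yN n Nn.
rewrite hnormBC in h5; rewrite (hnormBC (euler n t y)) in h7; lra.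
Qed.

Definition semigroup t x : E := xget 0 [set l | euler n t x @[n --> \oo] --> l].
Local Notation T := semigroup.

Lemma semigroup_cvg t x : 0 <= t -> euler n t x @[n --> \oo] --> T t x.
Proof.
move=> t0; apply: (@xgetPex _ 0 [set l | euler n t x @[n --> \oo] --> l]).
exact: euler_cvg.
Qed.

Arguments semigroup_cvg {t} x _.

Lemma semigroup_lin t : 0 <= t -> lin_map (T t).
Proof.
move=> t0 a x y; apply: (cvg_seq_unique (semigroup_cvg _ t0)).
under eq_fun do rewrite euler_lin.
by apply: cvgD; [apply: cvgZr|]; exact: semigroup_cvg.
Qed.

Lemma semigroup_contractive t : 0 <= t -> contractive (T t).
Proof.
move=> t0 x; apply: (cvgr_to_le (cvg_hnorm (semigroup_cvg x t0))).
by apply: nearW => n; exact: euler_contractive.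
Qed.

Lemma semigroup0 x : T 0 x = x.
Proof.
apply: (cvg_seq_unique (semigroup_cvg _ (lexx 0))).
rewrite (_ : (fun n => _) = cst x); first exact: cvg_cst.
by apply/funext => n; rewrite /euler nsteps0.
Qed.

Lemma eq_of_dense (f g : E -> E) : lin_map f -> lin_map g ->
  contractive f -> contractive g -> (forall x, opdom A x -> f x = g x) ->
  forall x, f x = g x.
Proof.
move=> fl gl fc gc fg x; apply/eqP; rewrite -subr_eq0; apply/eqP/hnorm0_eq0.
apply/eqP; rewrite eq_le hnorm_ge0 andbT; apply/ler_addgt0Pr => e e0.
have xA : closure (opdom A) x by exact: opdom_dense.
have e2 : 0 < e / 2 by lra.
have [y dy xy] := (closureP _ _).1 xA _ e2.
have h1 := hnorm_triangle (f y) (f x) (g x).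
rewrite -(lin_mapB x y fl) (fg y dy) -(lin_mapB y x gl) in h1.
have h2 := fc (x - y); have h3 := gc (y - x); rewrite hnormBC in h3; lra.
Qed.

(** The schemes for [s + t] and for [s] after [t] differ by at most one Euler step,
    which tends to the identity on the domain of [A]. *)
Lemma semigroupD s t x : 0 <= s -> 0 <= t -> T (s + t) x = T s (T t x).
Proof.
move=> s0 t0; have st0 := addr_ge0 s0 t0.
have cl : lin_map (T s \o T t).
  by move=> a y z /=; rewrite !semigroup_lin.
have cc : contractive (T s \o T t).
  by move=> z /=; apply: le_trans (semigroup_contractive s0 _) _; exact: semigroup_contractive.
apply: (@eq_of_dense (T (s + t)) (T s \o T t)) => //.
- exact: semigroup_lin.
- exact: semigroup_contractive.
move=> {}x dx /=; apply: (cvg_seq_unique (semigroup_cvg _ st0)).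
have h1 : euler n s (T t x) @[n --> \oo] --> T s (T t x) by exact: semigroup_cvg.
have h2 : hnorm (euler n t x - T t x) @[n --> \oo] --> (0 : R).
  by apply/cvg_hnorm0P; exact: semigroup_cvg.
have h3 : dstep R n * hnorm (A x) @[n --> \oo] --> (0 : R).
  by rewrite -(mul0r (hnorm (A x))); apply: cvgMl; exact: cvg_dstep.
move/cvg_hnorm0P in h1.
apply: (cvg_hnorm_le (u := fun n => dstep R n * hnorm (A x)
   + hnorm (euler n t x - T t x) + hnorm (euler n s (T t x) - T s (T t x)))).
  apply: nearW => n; have d0 := dstep_gt0 R n.
  apply: le_trans (hnorm_triangle (euler n s (T t x)) _ _) _; rewrite lerD2r.
  apply: le_trans (hnorm_triangle (euler n s (euler n t x)) _ _) _; apply: lerD.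
    rewrite /euler; have [e e1 ->] := nsteps_add n s0 t0.
    rewrite iterD -[iter (nsteps n s) _ (iter _ _ _)]iterD.
    have [dk ek] := iter_opdom (nsteps n s + nsteps n t) d0 dx.
    apply: le_trans (iter_resolvent_sub _ d0 dk) _; rewrite ek.
    apply: ler_pM => //.
    - by rewrite mulr_ge0// ltW.
    - exact: hnorm_ge0.
    - by rewrite ler_piMl ?(ltW d0)// (ler_nat R e 1).
    - by apply: iter_contractive; exact: Jc.
  rewrite -lin_mapB; first exact: euler_contractive.
  exact: euler_lin.
have -> : (0 : R) = 0 + 0 + 0 by rewrite !addr0.
by apply: cvgD => //; apply: cvgD.
Qed.

Lemma semigroup_sub t x : 0 <= t -> opdom A x -> hnorm (T t x - x) <= t * hnorm (A x).
Proof.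
move=> t0 dx; have h : hnorm (euler n t x - x) @[n --> \oo] --> hnorm (T t x - x).
  by apply: cvg_hnorm; apply: cvgB; [exact: semigroup_cvg|exact: cvg_cst].
apply: (cvgr_to_le h); apply: nearW => n.
apply: le_trans (iter_resolvent_sub _ (dstep_gt0 R n) dx) _.
by rewrite ler_wpM2r ?hnorm_ge0// nsteps_le.
Qed.

Lemma semigroup_resolvent t h x : 0 <= t -> 0 < h -> T t (J h x) = J h (T t x).
Proof.
move=> t0 h0; apply: (cvg_seq_unique (semigroup_cvg _ t0)).
have c := contractive_cvg (Jl h0) (Jc h0) (semigroup_cvg x t0).
apply: cvg_trans c; apply: near_eq_cvg; apply: nearW => n /=.
by rewrite /euler iter_comm// => z; rewrite /J (resolventC mA _ h0 (dstep_gt0 R n)).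
Qed.

(** The semigroup commutes with the resolvent [J 1], and [x = J 1 (x - A x)]. *)
Lemma semigroup_op t x : 0 <= t -> opdom A x ->
  opdom A (T t x) /\ A (T t x) = T t (A x).
Proof.
move=> t0 dx; have e1 : T t x = J 1 (T t (x - A x)).
  rewrite -semigroup_resolvent//; congr (T t _).
  by rewrite -[in RHS](scale1r (A x)) -(rmorph1 (real_complex R)) /J resolvent_uniq.
have d1 : opdom A (T t x) by rewrite e1; exact: resolvent_dom.
split => //; have := resolvent_eq mA (T t (x - A x)) ltr01.
rewrite -/(J 1) -e1 rmorph1 scale1r lin_mapB; last exact: semigroup_lin.
by move=> /addrI/oppr_inj.
Qed.

(** The auxiliary vector [y] serves two purposes. An approximation of [A x] by [y]
    gives differentiability at [0] for every [x] in the domain, while [y = A x]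
    gives a remainder of order [t^2] on the domain of [A^2]. *)
Lemma semigroup_taylor t x y : 0 <= t -> opdom A x -> opdom A y ->
  hnorm (T t x - x - t%:C *: A x) <= t * (2 * hnorm (A x - y) + t * hnorm (A y)).
Proof.
move=> t0 dx dy; pose K := 2 * hnorm (A x - y) + t * hnorm (A y).
have aux h k : 0 < h -> k%:R * h <= t ->
    hnorm (iter k (J h) x - x - (k%:R * h)%:C *: A x) <= k%:R * h * K.
  move=> h0; elim: k => [|k IH] kt; first by rewrite subrr !mul0r scale0r subr0 hnorm0.
  have kt' : k%:R * h <= t by apply: le_trans kt; rewrite ler_pM2r// ler_nat.
  have [dk ek] := iter_opdom k h0 dx.
  have [dk1 ek1] := iter_opdom k.+1 h0 dx.
  have incr : iter k.+1 (J h) x - iter k (J h) x = h%:C *: iter k.+1 (J h) (A x).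
    by rewrite -ek1 !iterS /J resolvent_incr.
  have -> : iter k.+1 (J h) x - x - (k.+1%:R * h)%:C *: A x =
     (iter k (J h) x - x - (k%:R * h)%:C *: A x)
      + h%:C *: (iter k.+1 (J h) (A x) - A x).
    rewrite scalerBr -incr -natr1 mulrDl mul1r rmorphD/= scalerDl.
    by rewrite [RHS]addrACA -opprD [X in _ = X + _]addrC subrKA.
  apply: le_trans (hnormD _ _) _; rewrite -natr1 !mulrDl mul1r; apply: lerD.
    exact: IH.
  rewrite hnormZr gtr0_norm// ler_pM2l//.
  have h1 := hnorm_triangle (iter k.+1 (J h) y) (iter k.+1 (J h) (A x)) (A x).
  have h2 := hnorm_triangle y (iter k.+1 (J h) y) (A x).
  have h3 := iter_resolvent_sub k.+1 h0 dy.
  have h4 : hnorm (iter k.+1 (J h) (A x) - iter k.+1 (J h) y) <= hnorm (A x - y).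
    rewrite -lin_mapB; first by apply: iter_contractive; exact: Jc.
    by apply: iter_lin; exact: Jl.
  have h5 : k.+1%:R * h * hnorm (A y) <= t * hnorm (A y).
    by rewrite ler_wpM2r ?hnorm_ge0.
  rewrite (hnormBC y) in h2; rewrite /K; lra.
have h1 : hnorm (euler n t x - x - ((nsteps n t)%:R * dstep R n)%:C *: A x)
    @[n --> \oo] --> hnorm (T t x - x - t%:C *: A x).
  apply: cvg_hnorm; apply: cvgB.
    by apply: cvgB; [exact: semigroup_cvg|exact: cvg_cst].
  apply/cvg_hnorm0P; under eq_fun do rewrite -scalerBl -rmorphB hnormZr.
  rewrite -(mul0r (hnorm (A x))); apply: cvgMl; apply/norm_cvg0P.
  rewrite -(subrr t); apply: cvgB; [exact: nsteps_cvg|exact: cvg_cst].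
apply: (cvgr_to_le h1); apply: nearW => n.
apply: le_trans (aux _ _ (dstep_gt0 R n) (nsteps_le n t0)) _.
rewrite ler_wpM2r ?nsteps_le// addr_ge0 ?mulr_ge0 ?hnorm_ge0//.
Qed.

Lemma semigroup_cvg0 x : T t x @[t --> 0^'+] --> x.
Proof.
apply/cvg_hnormP => e e0.
have xA : closure (opdom A) x by exact: opdom_dense.
have e3 : 0 < e / 3 by lra.
have [y dy xy] := (closureP _ _).1 xA _ e3.
have y1 : 0 < hnorm (A y) + 1 by have := hnorm_ge0 (A y); lra.
near=> t.
have t0 : 0 < t by near: t; exact: nbhs_right_gt.
have h1 := semigroup_sub (ltW t0) dy.
have h2 : t * (hnorm (A y) + 1) < e / 3.
  rewrite -ltr_pdivlMr//; near: t; apply: nbhs_right_lt; exact: divr_gt0.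
have h3 := hnorm_triangle (T t y) (T t x) x.
have h4 := hnorm_triangle y (T t y) x.
have h5 : hnorm (T t x - T t y) <= hnorm (x - y).
  by rewrite -lin_mapB; [exact: semigroup_contractive (ltW _) _|exact: semigroup_lin (ltW _)].
rewrite (hnormBC y) in h4; lra.
Unshelve. all: by end_near. Qed.

Lemma semigroup_derive x : opdom A x ->
  (t^-1)%:C *: (T t x - x) @[t --> 0^'+] --> A x.
Proof.
move=> dx; apply/cvg_hnormP => e e0.
have xA : closure (opdom A) (A x) by exact: opdom_dense.
have e3 : 0 < e / 4 by lra.
have [y dy xy] := (closureP _ _).1 xA _ e3.
have y1 : 0 < hnorm (A y) + 1 by have := hnorm_ge0 (A y); lra.
near=> t.
have t0 : 0 < t by near: t; exact: nbhs_right_gt.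
have h1 := semigroup_taylor (ltW t0) dx dy.
have h2 : t * (hnorm (A y) + 1) < e / 4.
  rewrite -ltr_pdivlMr//; near: t; apply: nbhs_right_lt; exact: divr_gt0.
have -> : (t^-1)%:C *: (T t x - x) - A x = (t^-1)%:C *: (T t x - x - t%:C *: A x).
  by rewrite [RHS]scalerBr scalerA -rmorphM mulVf ?gt_eqF// rmorph1 scale1r.
rewrite hnormZr gtr0_norm ?invr_gt0// -(ltr_pM2l t0) mulrA mulfV ?gt_eqF// mul1r.
apply: le_lt_trans h1 _; rewrite ltr_pM2l//; lra.
Unshelve. all: by end_near. Qed.

(** The generator extends [A] and is dissipative, the semigroup being contractive.
    Since [1 - A] is onto, [A] has no proper dissipative extension: with [r] the
    resolvent of [x - y], the difference [x - r] is mapped to itself by the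
    generator and therefore vanishes. *)
Lemma semigroup_derive_inv x y :
  (t^-1)%:C *: (T t x - x) @[t --> 0^'+] --> y -> opdom A x /\ A x = y.
Proof.
move=> xy; have [dr] := resolventP mA (x - y) ltr01.
set r := resolvent _ _ _ => er; rewrite rmorph1 scale1r in er.
have d1 := semigroup_derive dr.
have diss : ip (y - A r) (x - r) <= 0.
  have h : ip ((t^-1)%:C *: (T t x - x) - (t^-1)%:C *: (T t r - r)) (x - r)
      @[t --> 0^'+] --> ip (y - A r) (x - r).
    by apply: cvg_ip; [exact: cvgB|exact: cvg_cst].
  apply: (cvgr_to_le h); near=> t.
  have t0 : 0 < t by near: t; exact: nbhs_right_gt.
  rewrite -scalerBr ipZl pmulr_rle0 ?invr_gt0// subrACA -lin_mapB; last exact: semigroup_lin (ltW t0).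
  rewrite ipDl ipNl ipxx expr2 subr_le0; apply: le_trans (ip_le _ _) _.
  by rewrite ler_wpM2r ?hnorm_ge0//; exact: semigroup_contractive (ltW _) _.
have eq1 : y - A r = x - r.
  by rewrite -(subrKA r) addrC er subrKA.
have xr : x = r.
  apply/eqP; rewrite -subr_eq0; apply/eqP/ip_eq0/le_anti.
  by rewrite {2}ipxx sqr_ge0 andbT -[X in ip X _]eq1.
rewrite xr; split => //; apply/eqP; rewrite eq_sym -subr_eq0 eq1 xr subrr//.
Unshelve. all: by end_near. Qed.

End Semigroup.

(** * Stability from the absence of conservative orbits *)

Section Stability.
Variables (R : realType) (E : hilbertType R) (A : operator E E).
Hypothesis mA : mdissipative A.
Implicit Types (x y z p q r : E) (h s t : R) (n k : nat).

Local Notation T := (semigroup A).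
Local Notation J := (resolvent A 1).
Local Notation X0 := (orthocompl (op_ker A)).

Let linA : linear_operator A. Proof. by case: mA. Qed.
Let Jl : lin_map J := resolvent_lin mA ltr01.
Let Jc : contractive J := resolvent_contractive mA ltr01.

Lemma resolvent1_eq y : J y - A (J y) = y.
Proof. by have := resolvent_eq mA y ltr01; rewrite rmorph1 scale1r. Qed.

Lemma closure_ran : closure (op_ran A) = X0.
Proof.
rewrite ortho_closure ?ker_ortho_ran//.
by apply: subspace_ran; case: mA.
Qed.

(** The orthogonal complement of the kernel is the closure of the range, which is
    preserved by any contraction that commutes with [A]. *)
Lemma commute_ker_ortho (f : E -> E) : lin_map f -> contractive f ->
  (forall x, opdom A x -> opdom A (f x) /\ A (f x) = f (A x)) ->
  forall x, X0 x -> X0 (f x).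
Proof.
move=> fl fc fA x; rewrite -closure_ran => /closure_seq[s sA sx].
apply: (seq_closed (@closed_closure _ _) _ (contractive_cvg fl fc sx)) => n.
apply: subset_closure; have [w dw <-] := sA n.
by have [d e] := fA _ dw; exists (f w).
Qed.

Lemma semigroup_ker_ortho t x : 0 <= t -> X0 x -> X0 (T t x).
Proof.
move=> t0; apply: commute_ker_ortho; [exact: semigroup_lin|exact: semigroup_contractive|].
by move=> {}x; exact: semigroup_op.
Qed.

Lemma resolvent_ker_ortho x : X0 x -> X0 (J x).
Proof.
apply: commute_ker_ortho => // {}x dx.
by split; [exact: resolvent_dom|exact: resolvent_op].
Qed.

Lemma semigroup_nincr s t x : 0 <= s -> s <= t -> hnorm (T t x) <= hnorm (T s x).
Proof.
move=> s0 st; rewrite -[t](subrK s) semigroupD ?subr_ge0//.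
by apply: semigroup_contractive; rewrite ?subr_ge0.
Qed.

Lemma energy_cvg x : exists2 l : R, 0 <= l & hnorm (T n%:R x) @[n --> \oo] --> l.
Proof.
have : cvg (hnorm (T n%:R x) @[n --> \oo]).
  apply: nonincreasing_is_cvgn.
    by move=> m n mn; apply: semigroup_nincr; rewrite ?ler_nat.
  by exists 0 => _ [n _ <-]; exact: hnorm_ge0.
move=> /cvg_ex[l hl]; exists l => //.
by apply: (cvgr_to_ge hl); apply: nearW => n; exact: hnorm_ge0.
Qed.

(** The energy [|T t x|^2] decreases to a limit and has derivative
    [2 Re <A T t x, T t x>], which is Lipschitz in [t] for [x] in the domain of
    [A^2]; such a derivative tends to zero. Instead of differentiating, the loss of
    energy over a short time [t] is expanded to second order with a remainder that
    is uniform along the orbit. *)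
Lemma dissipation_cvg0 x : opdom_pow A 2 x ->
  ip (A (T n%:R x)) (T n%:R x) @[n --> \oo] --> (0 : R).
Proof.
move=> [dx [dAx _]]; pose a := hnorm (A x); pose b := hnorm (A (A x)).
pose M := 2 * hnorm x * b + 2 * a ^+ 2 + 2 * b ^+ 2.
have a0 : 0 <= a by exact: hnorm_ge0.
have b0 : 0 <= b by exact: hnorm_ge0.
have M0 : 0 <= M by rewrite !addr_ge0 ?mulr_ge0 ?hnorm_ge0 ?sqr_ge0.
pose e n := hnorm (T n%:R x) ^+ 2.
have key n t : 0 <= t -> t <= 1 ->
    - (2 * t * ip (A (T n%:R x)) (T n%:R x)) <= e n - e n.+1 + M * t ^+ 2.
  move=> t0 t1; have n0 : 0 <= n%:R :> R by [].
  have [dy ey] := semigroup_op mA n0 dx.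
  have [dy2 ey2] := semigroup_op mA n0 dAx.
  rewrite -ey in dy2 ey2; set y := T n%:R x in dy ey dy2 ey2 *.
  have hy : hnorm y <= hnorm x by exact: semigroup_contractive.
  have hAy : hnorm (A y) <= a by rewrite ey; exact: semigroup_contractive.
  have hAAy : hnorm (A (A y)) <= b by rewrite ey2; exact: semigroup_contractive.
  have e1 : e n.+1 <= hnorm (T t y) ^+ 2.
    rewrite ler_pXn2r ?nnegrE ?hnorm_ge0// -semigroupD//.
    by apply: semigroup_nincr; rewrite ?addr_ge0// -natr1 addrC lerD2l.
  have tay := semigroup_taylor mA t0 dy dy2.
  rewrite subrr hnorm0 mulr0 add0r mulrA -expr2 in tay.
  set rho := T t y - y - _ in tay.
  have rE : T t y = y + (t%:C *: A y + rho).
    by rewrite /rho [X in y + X]addrC subrK addrC subrK.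
  have rb : hnorm rho <= t ^+ 2 * b.
    by apply: le_trans tay _; rewrite ler_wpM2l// sqr_ge0.
  have w1 : ip y rho <= hnorm x * (t ^+ 2 * b).
    by apply: le_trans (ip_le _ _) _; apply: ler_pM; rewrite ?hnorm_ge0.
  have w2 : hnorm (t%:C *: A y + rho) <= t * a + t ^+ 2 * b.
    apply: le_trans (hnormD _ _) _; apply: lerD => //.
    by rewrite hnormZr ger0_norm// ler_wpM2l.
  have w3 : hnorm (t%:C *: A y + rho) ^+ 2 <= t ^+ 2 * (2 * a ^+ 2 + 2 * b ^+ 2).
    have c0 : 0 <= t * a + t ^+ 2 * b by rewrite addr_ge0 ?mulr_ge0 ?sqr_ge0.
    have w4 : hnorm (t%:C *: A y + rho) ^+ 2 <= (t * a + t ^+ 2 * b) ^+ 2.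
      by rewrite ler_pXn2r ?nnegrE ?hnorm_ge0.
    apply: le_trans w4 _; have -> : t * a + t ^+ 2 * b = t * (a + t * b) by ring.
    rewrite exprMn ler_wpM2l ?sqr_ge0//.
    have w5 : t * b <= b by rewrite ler_piMl.
    have w6 : 0 <= t * b by rewrite mulr_ge0.
    have w7 := sqr_ge0 (a - t * b).
    have w8 : (t * b) ^+ 2 <= b ^+ 2 by rewrite ler_pXn2r ?nnegrE.
    rewrite sqrrB in w7; rewrite sqrrD; lra.
  have e2 : hnorm (T t y) ^+ 2 = e n + 2 * t * ip (A y) y + 2 * ip y rho
     + hnorm (t%:C *: A y + rho) ^+ 2.
    by rewrite rE hnorm_sqrD ipDr ipZr (ipC y (A y)) /e -/y; ring.
  rewrite /M; lra.
have [l _ hl] := energy_cvg x.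
have ecvg : e n - e n.+1 @[n --> \oo] --> (0 : R).
  have h1 : e n @[n --> \oo] --> l ^+ 2 by rewrite /e !expr2; exact: cvgM.
  rewrite -(subrr (l ^+ 2)); apply: cvgB => //.
  by rewrite (cvg_shiftS e).
apply/cvgr0Pnorm_lt => eps eps0.
(* The error M t^2 of the expansion is at most eps t, and the energy lost in one
   unit of time is eventually below eps t. *)
pose t := Num.min 1 (eps / (M + 1)).
have M1 : 0 < M + 1 by lra.
have t0 : 0 < t by rewrite lt_min ltr01 divr_gt0.
have t1 : t <= 1 by rewrite ge_min lexx.
have tM : M * t <= eps.
  have : t <= eps / (M + 1) by rewrite ge_min lexx orbT.
  by rewrite ler_pdivlMr// => h; nra.
have et : 0 < eps * t by rewrite mulr_gt0.
move/cvgr0Pnorm_lt/(_ _ et): ecvg; apply: filterS => n hn.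
have [dy _] := semigroup_op mA (ler0n R n) dx.
rewrite ler0_norm; last exact: dissipative_ip.
have k1 := key n t (ltW t0) t1.
have k2 : e n - e n.+1 < eps * t by apply: le_lt_trans hn; exact: ler_norm.
rewrite -(ltr_pM2l t0); nra.
Qed.

(** [Q] stands for a space of states without dissipation. *)
Variable Q : set E.
Hypothesis sQ : subspace_set Q.
Hypothesis cQ : closed Q.
Hypothesis Q_conserv : forall r, opdom A r -> Q r -> ip (A r) r = 0.

(** The part of the complement of the kernel on which the evolution is
    conservative. Invariance is imposed for the resolvent instead of the
    semigroup: [J] carries the compactness, and [conserved] is then stable under
    [J] by construction. *)
Definition conserved : set E := [set p | X0 p /\ forall k, Q (iter k J p)].
Local Notation N := conserved.

Lemma conserved_subspace : subspace_set N.
Proof.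
split; first by split=> [|k]; [exact: (subspace0 (subspace_ortho _))|
  rewrite (lin_map0 (iter_lin k Jl)); exact: subspace0].
move=> a p q [Xp Qp] [Xq Qq]; split=> [|k]; first by case: (subspace_ortho (op_ker A)) => _; exact.
by rewrite (iter_lin k Jl); case: sQ => _; exact.
Qed.

Lemma conserved_resolvent p : N p -> N (J p).
Proof.
by move=> [Xp Qp]; split=> [|k]; [exact: resolvent_ker_ortho|rewrite -iterSr].
Qed.

Lemma conserved_closed : closed N.
Proof.
move=> p /closure_seq[s sN sp]; split=> [|k].
  by apply: (seq_closed (@closed_ortho _ _ _) _ sp) => n; case: (sN n).
apply: (seq_closed cQ _ (contractive_cvg (iter_lin k Jl) (iter_contractive k Jc) sp)).
by move=> n; case: (sN n).
Qed.

Lemma conserved_ip p : N p -> ip p (J p) = hnorm (J p) ^+ 2.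
Proof.
move=> [_ Qp]; rewrite -{1}(resolvent1_eq p) ipDl ipNl Q_conserv ?subr0 ?ipxx//.
  exact: resolvent_dom.
exact: (Qp 1%N).
Qed.

(** Polarising [Re <p, J p> = |J p|^2]: on [conserved], [2 J - 1] is an isometry,
    namely the Cayley transform of the skew operator [A]. *)
Lemma conserved_polar p q : N p -> N q ->
  ip (J p) q + ip p (J q) = 2 * ip (J p) (J q).
Proof.
move=> Np Nq; have := conserved_ip (subspaceD conserved_subspace Np Nq).
rewrite (lin_mapD _ _ Jl) hnorm_sqrD !ipE !conserved_ip// (ipC q) => h; lra.
Qed.

Hypothesis Q_compact : forall (p : nat -> E), (forall n, hnorm (p n) <= 1) ->
  (forall n, X0 (p n)) -> (forall n, Q (J (p n))) ->
  exists (f : nat -> nat) (l : E), (forall n, (n <= f n)%N) /\ J (p (f n)) @[n --> \oo] --> l.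

(** A vector at which [|J p|^2 <= mu |p|^2] is an equality solves the Euler
    equation [J^* J r = mu r]. So does [J r], by the isometry relation, and both
    facts combine to a quadratic equation for [J] at [r]. The eigenvalues of [J]
    are thus reached without finite-dimensional linear algebra on an eigenspace of
    [J^* J]. *)
Section Maximizer.
Variable mu : R.
Hypothesis mu_max : forall p, N p -> hnorm (J p) ^+ 2 <= mu * hnorm p ^+ 2.

Lemma conserved_CS p q : N p -> N q ->
  (mu * ip p q - ip (J p) (J q)) ^+ 2 <=
  (mu * hnorm p ^+ 2 - hnorm (J p) ^+ 2) * (mu * hnorm q ^+ 2 - hnorm (J q) ^+ 2).
Proof.
move=> Np Nq; apply: quad_ge0; rewrite ?subr_ge0 ?mu_max// => t.
have Ntq : N (t%:C *: q) by exact: subspaceZ conserved_subspace _.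
have := mu_max (subspaceD conserved_subspace Np Ntq).
rewrite (lin_mapD _ _ Jl) (lin_mapZ _ _ Jl) !hnorm_sqrD !ipE !hnormZr !exprMn real_normK ?num_real// => h.
lra.
Qed.

Lemma maximizer_quadratic r : N r -> hnorm (J r) ^+ 2 = mu * hnorm r ^+ 2 ->
  J (J r) = (2 * mu)%:C *: J r - mu%:C *: r.
Proof.
move=> Nr rmax; have NJr := conserved_resolvent Nr.
have E0 q p : N p -> N q -> hnorm (J p) ^+ 2 = mu * hnorm p ^+ 2 ->
    ip (J p) (J q) = mu * ip p q.
  move=> Np Nq pmax; have := conserved_CS Np Nq.
  rewrite pmax subrr mul0r => h; apply/eqP; rewrite eq_sym -subr_eq0 -sqrf_eq0.
  by rewrite eq_le h sqr_ge0.
have JrE : hnorm (J (J r)) ^+ 2 = mu * hnorm (J r) ^+ 2.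
  by rewrite -conserved_ip// E0// conserved_ip.
set w := _ - _; have Nw : N (J (J r) - w).
  have sN := conserved_subspace.
  apply: subspaceB => //; first exact: conserved_resolvent.
  by apply: subspaceB => //; exact: subspaceZ.
apply/eqP; rewrite -subr_eq0; apply/eqP/ip_eq0.
move: Nw; set q := _ - w => Nq.
have h1 := conserved_polar NJr Nq.
rewrite (E0 _ _ NJr Nq JrE) (E0 _ _ Nr Nq rmax) in h1.
have qE : q = J (J r) - w by [].
by clearbody q; rewrite {1}qE /w !ipE; lra.
Qed.

End Maximizer.

Hypothesis no_eigen : forall (l : R) x, l != 0 -> opdom A x ->
  A x = (l%:C * 'i) *: x -> x = 0.

(** The circle [|s|^2 = Re s] contains exactly the nonzero values [s = 1 / (1 - i l)]
    with [l] real, so such an eigenvalue [s] of [J] corresponds to the eigenvalue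
    [i l] of [A], which is excluded for [l <> 0] by hypothesis and for [l = 0] by
    orthogonality to the kernel. *)
Lemma conserved_eigen (mu nu : R) w : 0 < mu -> mu ^+ 2 + nu ^+ 2 = mu ->
  N w -> J w = (mu +i* nu) *: w -> w = 0.
Proof.
move=> mu0 munu Nw Jw; set s := _ +i* _ in Jw.
have ss : (mu -i* nu) * s = mu%:C.
  by rewrite -[in RHS]munu /s; apply/eqP; rewrite eq_complex /=; apply/andP; split; apply/eqP; ring.
have mC : mu%:C != 0 :> R[i] by apply/eqP => /complexI h; rewrite h ltxx in mu0.
have wE : w = (mu^-1%:C * (mu -i* nu)) *: J w.
  rewrite Jw scalerA -mulrA ss -rmorphM mulVf ?gt_eqF//.
  by rewrite rmorph1 scale1r.
have dw : opdom A w.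
  by rewrite wE; apply: (subspaceZ _ linA.1); exact: resolvent_dom.
have AJ : A (J w) = J w - w by rewrite -{3}(resolvent1_eq w) opprB addrC subrK.
have Aw : A w = ((nu / mu)%:C * 'i) *: w.
  rewrite {1}wE (linopZ linA); last exact: resolvent_dom.
  rewrite AJ scalerBr -wE -{1}[w]scale1r -scalerBl; congr (_ *: _).
  apply/eqP; rewrite eq_complex /=; apply/andP; split; apply/eqP; field; lra.
have [nu0|nuN] := eqVneq nu 0.
  have kw : op_ker A w by split => //; rewrite Aw nu0 mul0r rmorph0 mul0r scale0r.
  by apply: ip_eq0; apply: (ortho_ip _ kw); case: Nw.
by apply: no_eigen dw Aw; rewrite mulf_neq0// invr_neq0// gt_eqF.
Qed.

(** If [conserved] were nontrivial, the supremum [mu] of [|J p|^2] over its unit ball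
    would be positive. Compactness makes [J s_n] converge to some [r] along a
    maximising sequence [s_n]. The sequence itself need not converge, but the
    Cauchy-Schwarz inequality for the form [mu |p|^2 - |J p|^2] shows that [r] is a
    maximiser up to scaling. The quadratic equation at [r] then has a linear factor
    with a nonzero eigenvector of [J]. *)
Lemma conserved_trivial p : N p -> p = 0.
Proof.
move=> Np; apply: contrapT => p0.
pose S := [set hnorm (J q) ^+ 2 | q in [set q | N q /\ hnorm q <= 1]].
have sN := conserved_subspace.
have S_sup : has_sup S.
  split; first by exists (hnorm (J 0) ^+ 2); exists 0 => //; split; [exact: subspace0|rewrite hnorm0].
  exists 1 => _ [q [_ q1] <-]; rewrite expr_le1 ?hnorm_ge0//.
  by apply: le_trans q1; exact: Jc.
pose mu := sup S.
have mu1 : mu <= 1.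
  apply: sup_le_ub; first by case: S_sup.
  move=> _ [q [_ q1] <-]; rewrite expr_le1 ?hnorm_ge0//.
  by apply: le_trans q1; exact: Jc.
have mu_max q : N q -> hnorm (J q) ^+ 2 <= mu * hnorm q ^+ 2.
  move=> Nq; have [q0|q0] := eqVneq (hnorm q) 0.
    by rewrite (hnorm0_eq0 q0) (lin_map0 Jl) hnorm0 expr0n mulr0.
  have qp : 0 < hnorm q by rewrite lt_neqAle eq_sym q0 hnorm_ge0.
  have : hnorm (J ((hnorm q)^-1%:C *: q)) ^+ 2 <= mu.
    apply: ub_le_sup; first by case: S_sup.
    exists ((hnorm q)^-1%:C *: q) => //; split; first exact: subspaceZ.
    by rewrite hnormZr ger0_norm ?mulVf// invr_ge0 hnorm_ge0.
  rewrite (lin_mapZ _ _ Jl) hnormZr ger0_norm ?invr_ge0 ?hnorm_ge0// exprMn exprVn.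
  by rewrite mulrC ler_pdivrMr// exprn_gt0.
have mu_gt0 : 0 < mu.
  rewrite ltNge; apply/negP => mu0; apply: p0.
  have h1 := mu_max _ Np.
  have Jp0 : J p = 0.
    apply: hnorm0_eq0; apply/eqP; rewrite -sqrf_eq0 eq_le sqr_ge0 andbT.
    by apply: le_trans h1 _; rewrite mulr_le0_ge0// sqr_ge0.
  by rewrite -(resolvent1_eq p) Jp0 (linop0 linA) subrr.
have ex n : exists q, [/\ N q, hnorm q <= 1 & mu - harmonic n < hnorm (J q) ^+ 2].
  have [_ [q [Nq q1] <-] hq] := sup_adherent (harmonic_gt0 n) S_sup.
  by exists q.
have [s sP] := choice ex.
have sNn n : N (s n) by case: (sP n).
have [n|n|n|f [r [fn sr]]] := @Q_compact s.
- by case: (sP n).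
- by case: (sNn n).
- by case: (sNn n) => _ /(_ 1%N).
have Nr : N r.
  by apply: (seq_closed conserved_closed _ sr) => n; exact: conserved_resolvent.
have hf : harmonic (f n) @[n --> \oo] --> (0 : R).
  exact: (cvg_reindex fn (@cvg_harmonic R)).
have sup1 n : hnorm (J (s n)) ^+ 2 <= mu.
  have [Nn n1 _] := sP n; apply: le_trans (mu_max _ Nn) _.
  by rewrite ler_piMr ?(ltW mu_gt0)// expr_le1 ?hnorm_ge0.
have r2 : hnorm (J (s (f n))) ^+ 2 @[n --> \oo] --> hnorm r ^+ 2.
  by rewrite !expr2; apply: cvgM; exact: cvg_hnorm.
have rmu : hnorm r ^+ 2 = mu.
  apply: (cvg_unique _ r2); first exact: Rhausdorff.
  apply: (@squeeze_cvgr _ _ _ _ (fun n => mu - harmonic (f n)) (cst mu)).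
  - by apply: nearW => n /=; rewrite sup1 andbT ltW//; case: (sP (f n)).
  - by rewrite -[X in _ --> X]subr0; apply: cvgB => //; exact: cvg_cst.
  - exact: cvg_cst.
have Jr2 : hnorm (J (J (s (f n)))) ^+ 2 @[n --> \oo] --> hnorm (J r) ^+ 2.
  by rewrite !expr2; apply: cvgM; apply: cvg_hnorm; exact: contractive_cvg.
have rmax : hnorm (J r) ^+ 2 = mu * hnorm r ^+ 2.
  apply/eqP; rewrite eq_sym -subr_eq0 -sqrf_eq0 eq_le sqr_ge0 andbT.
  have lim1 : (mu * hnorm (J (s (f n))) ^+ 2 - hnorm (J (J (s (f n)))) ^+ 2) ^+ 2
      @[n --> \oo] --> (mu * hnorm r ^+ 2 - hnorm (J r) ^+ 2) ^+ 2.
    have lim2 : mu * hnorm (J (s (f n))) ^+ 2 - hnorm (J (J (s (f n)))) ^+ 2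
      @[n --> \oo] --> mu * hnorm r ^+ 2 - hnorm (J r) ^+ 2.
      by apply: cvgB => //; exact: cvgMr.
    by rewrite !expr2; exact: cvgM.
  have lim3 : harmonic (f n) * mu @[n --> \oo] --> (0 : R).
    by rewrite -(mul0r mu); exact: cvgMl.
  apply: (ler_cvg_to lim1 lim3); apply: nearW => n.
  have [Nn n1 hn] := sP (f n); have NJ := conserved_resolvent Nn.
  have := conserved_CS mu_max Nn NJ.
  rewrite !conserved_ip// => h; apply: le_trans h _; apply: ler_pM.
  - by rewrite subr_ge0 mu_max.
  - by rewrite subr_ge0 mu_max.
  - rewrite lerBlDr -lerBlDl; apply: le_trans (ltW hn).
    by rewrite lerB// ler_piMr ?(ltW mu_gt0)// expr_le1 ?hnorm_ge0.
  - have := sup1 (f n); have := sqr_ge0 (hnorm (J (J (s (f n))))) => h1 h2; nra.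
have quad := maximizer_quadratic mu_max Nr rmax.
have r0 : r <> 0 by move=> r0; move: rmu mu_gt0; rewrite r0 hnorm0 expr0n /= => <-; rewrite ltxx.
have [nu munu] : exists nu, mu ^+ 2 + nu ^+ 2 = mu.
  exists (Num.sqrt (mu - mu ^+ 2)); rewrite sqr_sqrtr; first by ring.
  by rewrite subr_ge0 expr2; apply: ler_piMl => //; exact: ltW.
have munu' : mu ^+ 2 + (- nu) ^+ 2 = mu by rewrite sqrrN munu.
(* J^2 - 2 mu J + mu factors as (J - s) (J - conj s) with s = mu + i nu. *)
pose q := J r - (mu -i* nu) *: r.
have Nq : N q by apply: subspaceB => //; [exact: conserved_resolvent|exact: subspaceZ].
have Jq : J q = (mu +i* nu) *: q.
  rewrite /q (lin_mapB _ _ Jl) (lin_mapZ _ _ Jl) quad scalerBr scalerA.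
  have -> : (mu +i* nu) * (mu -i* nu) = mu%:C.
    by rewrite -[in RHS]munu; apply/eqP; rewrite eq_complex /=; apply/andP; split; apply/eqP; ring.
  rewrite addrAC -scalerBl; congr (_ *: _ - _).
  by apply/eqP; rewrite eq_complex /=; apply/andP; split; apply/eqP; ring.
have q0 := conserved_eigen mu_gt0 munu Nq Jq.
apply: r0; apply: (conserved_eigen mu_gt0 munu' Nr).
by apply/eqP; rewrite -subr_eq0; apply/eqP.
Qed.

Hypothesis orbit_compact : forall x (f : nat -> nat), opdom_pow A 3 x ->
  (forall n, (n <= f n)%N) ->
  exists (g : nat -> nat) (l : E), [/\ forall n, (n <= g n)%N, Q l &
    T (f (g n))%:R (A x) @[n --> \oo] --> l].

(** LaSalle's argument. A limit point [p] of the orbit of [A x] has norm equal to the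
    limit of the norms along the orbit. Its resolvents [J^k p] are limit points of the orbits of
    [A (J^k x)], so all of them lie in [Q], and [p] is conserved, hence zero. *)
Lemma stable_range x : opdom_pow A 3 x -> hnorm (T n%:R (A x)) @[n --> \oo] --> (0 : R).
Proof.
move=> dx; have [l l0 hl] := energy_cvg (A x).
have [f [p [fn Qp Tp]]] := orbit_compact (f := id) dx (fun n => leqnn n).
have hp : hnorm p = l.
  apply: (cvg_unique _ (cvg_hnorm Tp)); first exact: Rhausdorff.
  exact: (cvg_reindex fn hl).
suff p0 : p = 0 by rewrite -hp p0 hnorm0 in hl.
have X0A y : opdom A y -> X0 (A y).
  by move=> dy; rewrite -closure_ran; apply: subset_closure; exists y.
apply: conserved_trivial; split.
  apply: (seq_closed (@closed_ortho _ _ _) _ Tp) => n.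
  by apply: semigroup_ker_ortho => //; apply: X0A; case: dx.
move=> k; have dk : opdom_pow A 3 (iter k J x).
  elim: k => // k IH; rewrite iterS; apply: opdom_powS; exact: resolvent_opdom_pow.
have [g [q [gn Qq Tq]]] := orbit_compact dk fn.
suff -> : iter k J p = q by [].
have h1 := contractive_cvg (iter_lin k Jl) (iter_contractive k Jc) Tp.
have h2 := cvg_reindex gn h1.
apply: (cvg_seq_unique h2); apply: cvg_trans Tq; apply: near_eq_cvg; apply: nearW => n /=.
have dx1 : opdom A x by case: dx.
have [_ ->] := iter_opdom mA k ltr01 dx1.
elim: k {dk h1 h2} => // k IH; rewrite !iterS.
by rewrite semigroup_resolvent// IH.
Qed.

(** The vectors [A x] with [x] in the domain of [A^3] are dense in the complement of
    the kernel, as double resolvents approximate the identity. *)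
Lemma lasalle_stability x : X0 x -> hnorm (T t x) @[t --> +oo] --> (0 : R).
Proof.
rewrite -closure_ran => /closureP Xx; apply/cvgr0Pnorm_lt => e e0.
have e4 : 0 < e / 8 by lra.
have [_ [w dw <-] xw] := Xx _ e4.
have [d d0 dP] := resolvent_cvg mA (A w) e4.
pose h := d / 2; have h0 : 0 < h by rewrite /h; lra.
pose y := resolvent A h (resolvent A h w).
have dy : opdom_pow A 3 y by do 2!apply: resolvent_opdom_pow => //.
have Ay : A y = resolvent A h (resolvent A h (A w)).
  by rewrite /y !resolvent_op//; exact: resolvent_dom.
have a1 : hnorm (resolvent A h (A w) - A w) < e / 8 by apply: dP => //; rewrite /h; lra.
have a2 : hnorm (A y - resolvent A h (A w)) < e / 8.
  by rewrite Ay -lin_mapB; [apply: le_lt_trans a1; exact: resolvent_contractive|exact: resolvent_lin].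
have xy : hnorm (x - A y) < e / 2.
  have b1 := hnorm_triangle (A w) x (A y).
  have b2 := hnorm_triangle (resolvent A h (A w)) (A w) (A y).
  rewrite hnormBC in a1; rewrite hnormBC in a2; lra.
have e2 : 0 < e / 2 by lra.
have /cvgr0Pnorm_lt/(_ _ e2)[n _ hn] := stable_range dy.
have {}hn := hn n (leqnn n); rewrite /= ger0_norm ?hnorm_ge0// in hn.
near=> t.
have nt : n%:R <= t by near: t; exact: nbhs_pinfty_ge.
have t0 : 0 <= t by apply: le_trans nt.
rewrite ger0_norm ?hnorm_ge0//.
have -> : T t x = T t (x - A y) + T t (A y).
  by rewrite -lin_mapD ?subrK//; exact: semigroup_lin.
have c1 := hnormD (T t (x - A y)) (T t (A y)).
have c2 : hnorm (T t (x - A y)) <= hnorm (x - A y) by exact: semigroup_contractive.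
have c3 : hnorm (T t (A y)) <= hnorm (T n%:R (A y)) by exact: semigroup_nincr.
lra.
Unshelve. all: by end_near. Qed.

End Stability.

(** * The product space *)

Section Product.
Variables (R : realType) (E F : hilbertType R).
Implicit Types p q : hprod E F.

Lemma ip_pair p q : ip p q = ip p.1 q.1 + ip p.2 q.2.
Proof. by rewrite /ip hprod_dotE raddfD. Qed.

Lemma hnorm_pair p : hnorm p ^+ 2 = hnorm p.1 ^+ 2 + hnorm p.2 ^+ 2.
Proof. by rewrite -!ipxx ip_pair. Qed.

Lemma hnorm_fst p : hnorm p.1 <= hnorm p.
Proof.
by rewrite -(@ler_pXn2r _ 2) ?nnegrE ?hnorm_ge0// hnorm_pair lerDl sqr_ge0.
Qed.

Lemma hnorm_snd p : hnorm p.2 <= hnorm p.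
Proof.
by rewrite -(@ler_pXn2r _ 2) ?nnegrE ?hnorm_ge0// hnorm_pair lerDr sqr_ge0.
Qed.

Lemma hnorm_pair_le p : hnorm p <= hnorm p.1 + hnorm p.2.
Proof.
rewrite -(@ler_pXn2r _ 2) ?nnegrE ?addr_ge0 ?hnorm_ge0// hnorm_pair sqrrD.
have h := mulr_ge0 (hnorm_ge0 p.1) (hnorm_ge0 p.2); lra.
Qed.

Lemma cvg_fst (s : nat -> hprod E F) p : s @ \oo --> p -> (s n).1 @[n --> \oo] --> p.1.
Proof.
move=> /cvg_hnorm0P sp; apply: (cvg_hnorm_le _ sp); apply: nearW => n.
exact: (hnorm_fst (s n - p)).
Qed.

Lemma cvg_snd (s : nat -> hprod E F) p : s @ \oo --> p -> (s n).2 @[n --> \oo] --> p.2.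
Proof.
move=> /cvg_hnorm0P sp; apply: (cvg_hnorm_le _ sp); apply: nearW => n.
exact: (hnorm_snd (s n - p)).
Qed.

Lemma cvg_hpair (s : nat -> hprod E F) p : (s n).1 @[n --> \oo] --> p.1 ->
  (s n).2 @[n --> \oo] --> p.2 -> s @ \oo --> p.
Proof.
move=> /cvg_hnorm0P h1 /cvg_hnorm0P h2.
apply: (cvg_hnorm_le (u := fun n => hnorm ((s n).1 - p.1) + hnorm ((s n).2 - p.2))).
  by apply: nearW => n; exact: (hnorm_pair_le (s n - p)).
by rewrite -(addr0 (0 : R)); exact: cvgD.
Qed.

End Product.

(** * Densely defined closed operators and compactness *)

Section ClosedOperator.
Variables (R : realType) (E F : hilbertType R) (C : operator E F).
Hypothesis C_linear : linear_operator C.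
Hypothesis C_dense : dense (opdom C).
Hypothesis C_closed : closed (op_graph C).

Local Notation Cs := (op_adjoint C).

Let sC : subspace_set (opdom C) := C_linear.1.
Let CD := linopD C_linear.
Let C0 := linop0 C_linear.
Let CZ := linopZ C_linear.
Let CB := linopB C_linear.

Lemma closed_graph (s : nat -> E) x y : (forall n, opdom C (s n)) ->
  s @ \oo --> x -> C (s n) @[n --> \oo] --> y -> opdom C x /\ C x = y.
Proof.
move=> sd sx sy; suff h : op_graph C (x, y) by [].
apply: C_closed => B.
have h : (s n, C (s n)) @[n --> \oo] --> (x, y) by exact: cvg_pair.
move=> /h [N _ hN]; exists (s N, C (s N)); split; first by split => /=.
exact: (hN N (leqnn N)).
Qed.

Lemma opdom_dense_closure x : closure (opdom C) x.
Proof.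
move=> B xB; have [y [yB yd]] : (interior B) `&` opdom C !=set0.
  by apply: C_dense; [exists x|exact: open_interior].
by exists y; split => //; exact: interior_subset.
Qed.

Lemma ortho_opdom x : (forall y, opdom C y -> '[y, x] = 0) -> x = 0.
Proof.
move=> h; have [s sd sx] := closure_seq (@opdom_dense_closure x).
apply: ip_eq0; apply: (cvg_unique _ (cvg_ip sx (cvg_cst x))); first exact: Rhausdorff.
rewrite (_ : (fun n => _) = cst 0); first exact: cvg_cst.
by apply/funext => n /=; rewrite /ip h.
Qed.

Lemma adjointP y : opdom Cs y -> forall x, opdom C x -> '[C x, y] = '[x, Cs y].
Proof.
move=> [_ [z zP]].
by have [] := @xgetPex _ 0 [set z | setT z /\ forall x, opdom C x -> '[C x, y] = '[x, z]]
  (ex_intro _ z zP).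
Qed.

Lemma adjoint_ip y x : opdom Cs y -> opdom C x -> ip (C x) y = ip x (Cs y).
Proof. by move=> dy dx; rewrite /ip adjointP. Qed.

Lemma adjointE y z : (forall x, opdom C x -> '[C x, y] = '[x, z]) ->
  opdom Cs y /\ Cs y = z.
Proof.
move=> yz; have dy : opdom Cs y by split => //; exists z.
split=> //; apply/eqP; rewrite -subr_eq0; apply/eqP/ortho_opdom => x dx.
by rewrite linearB/= -adjointP// yz// subrr.
Qed.

Lemma adjoint_linear : linear_operator Cs.
Proof.
have comb (a : R[i]) x y : opdom Cs x -> opdom Cs y ->
    opdom Cs (a *: x + y) /\ Cs (a *: x + y) = a *: Cs x + Cs y.
  move=> dx dy; apply: adjointE => z dz.
  by rewrite !dotDr !dotZr !adjointP.
split; last by move=> a x y dx dy; case: (comb a x y dx dy).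
split; last by move=> a x y dx dy; case: (comb a x y dx dy).
have [|//] := @adjointE 0 0 _.
by move=> x _; rewrite !linear0.
Qed.

Lemma adjoint_closed (s : nat -> F) y z : (forall n, opdom Cs (s n)) ->
  s @ \oo --> y -> Cs (s n) @[n --> \oo] --> z -> opdom Cs y /\ Cs y = z.
Proof.
move=> sd sy sz; apply: adjointE.
have h x : opdom C x -> ip (C x) y = ip x z.
  move=> dx; apply: (cvg_unique _ (cvg_ip (cvg_cst (C x)) sy)); first exact: Rhausdorff.
  rewrite (_ : (fun n => _) = (fun n => ip x (Cs (s n)))); first exact: cvg_ip (cvg_cst x) sz.
  by apply/funext => n /=; exact: adjoint_ip.
move=> x dx; apply: dot_eq; first exact: h.
have dix : opdom C ('i *: x) by exact: subspaceZ.
have := h _ dix; rewrite CZ// -Im_dot /ip !dotZl.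
by case: '[C x, y] => a b; case: '[x, z] => c d /= e; lra.
Qed.

(** The graph of [C] is a closed subspace of the product, hence equals its double
    orthogonal complement; the pairs orthogonal to it are [(- C^* b, b)]. *)
Lemma double_adjoint f g : (forall v, opdom Cs v -> '[g, v] = '[f, Cs v]) ->
  opdom C f /\ C f = g.
Proof.
move=> fg; pose G : set (hprod E F) := [set p | opdom C p.1 /\ C p.1 = p.2].
have sG : subspace_set G.
  split; first by split; [exact: subspace0|exact: C0].
  move=> a [x1 y1] [x2 y2] [/= d1 <-] [/= d2 <-].
  by split=> /=; [exact: sC.2|rewrite CD ?CZ//; exact: subspaceZ].
have cG : closed G.
  move=> p /closure_seq[s sGn sp]; apply: (@closed_graph (fun n => (s n).1)).
  - by move=> n; case: (sGn n).
  - exact: cvg_fst.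
  - rewrite (_ : (fun n => _) = (fun n => (s n).2)); first exact: cvg_snd.
    by apply/funext => n; case: (sGn n).
suff h : G ((f, g) : hprod E F) by [].
apply: (ortho_ortho sG cG) => -[a b] hab.
have [db eb] : opdom Cs b /\ Cs b = - a.
  apply: adjointE => x dx.
  have := ortho_sym hab (_ : G (x, C x)); rewrite hprod_dotE /= => h.
  by apply/eqP; rewrite linearN /= -addr_eq0 addrC h.
by rewrite hprod_dotE /= fg// eb linearN /= subrr.
Qed.

Lemma closed_ker : closed (op_ker C).
Proof.
move=> x /closure_seq[s sk sx]; apply: (@closed_graph s) => //.
  by move=> n; case: (sk n).
rewrite (_ : (fun n => _) = cst 0); first exact: cvg_cst.
by apply/funext => n; case: (sk n).
Qed.

Lemma ortho_ran : orthocompl (op_ran C) = op_ker Cs.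
Proof.
apply/seteqP; split=> y.
  move=> hy; apply: adjointE => x dx.
  by rewrite (ortho_sym hy) ?linear0//; exists x.
move=> [dy y0] _ [x dx <-].
by rewrite dotC adjointP// y0 linear0 conjc0.
Qed.

(** Removing the projection onto the kernel changes neither membership in the domain
    nor the value of [C]; this is how states enter the set in which the embedding
    is compact. *)
Lemma ker_decomp u : exists2 w, op_ker C w &
  [/\ orthocompl (op_ker C) (u - w), hnorm (u - w) <= hnorm u &
      opdom C u -> opdom C (u - w) /\ C (u - w) = C u].
Proof.
have [w kw ow] := projection u (subspace_ker C_linear) closed_ker.
exists w => //; split=> //.
  rewrite -(@ler_pXn2r _ 2) ?nnegrE ?hnorm_ge0//.
  rewrite -[in leRHS](subrK w u) [leRHS]hnorm_sqrD (ortho_ip ow kw) mulr0 addr0.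
  by rewrite lerDl sqr_ge0.
case: kw => dw w0 du; split; first exact: subspaceB.
by rewrite CB// w0 subr0.
Qed.

Local Notation V := (opdom C `&` orthocompl (op_ker C)).
Hypothesis C_compact : compact_embedding V (graph_norm C).

Lemma embedding_subseq (a : nat -> E) (M : R) : (forall n, V (a n)) ->
  (forall n, hnorm (a n) <= M) -> (forall n, hnorm (C (a n)) <= M) ->
  exists (f : nat -> nat) (l : E), (forall n, (n <= f n)%N) /\ a (f n) @[n --> \oo] --> l.
Proof.
move=> aV aM CaM.
pose B := V `&` [set x | graph_norm C x <= Num.sqrt (M ^+ 2 + M ^+ 2)].
have pB : precompact B.
  apply: C_compact; first by move=> x [].
  by exists (Num.sqrt (M ^+ 2 + M ^+ 2)) => x [].
apply: (precompact_subseq pB) => n; split; first exact: aV.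
have M0 : 0 <= M by apply: le_trans (aM 0%N); exact: hnorm_ge0.
by apply: ler_wsqrtr; apply: lerD; rewrite ler_pXn2r ?nnegrE ?hnorm_ge0.
Qed.

(** Otherwise there are unit vectors [a_n] in the compactly embedded set with [C a_n]
    tending to zero. A limit of a subsequence is a unit vector which belongs to the
    kernel of [C], as the graph is closed, and is orthogonal to it. *)
Lemma bounded_below : exists2 K : R, 0 <= K & forall a, V a -> hnorm a <= K * hnorm (C a).
Proof.
apply: contrapT => hK.
have ex n : exists a, [/\ V a, hnorm a = 1 & hnorm (C a) < harmonic n].
  apply: contrapT => hn; apply: hK; exists n.+1%:R => // a [da oa].
  rewrite leNgt; apply/negP => ha; apply: hn.
  have a0 : 0 < hnorm a by apply: le_lt_trans ha; rewrite mulr_ge0 ?hnorm_ge0.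
  have ia0 : 0 <= (hnorm a)^-1 by rewrite invr_ge0 ltW.
  exists ((hnorm a)^-1%:C *: a); split.
  - by split; [exact: subspaceZ|exact: subspaceZ (subspace_ortho _) _].
  - by rewrite hnormZr ger0_norm// mulVf// gt_eqF.
  - rewrite CZ// hnormZr ger0_norm// /harmonic -(ltr_pM2l a0) mulrA mulfV ?gt_eqF// mul1r.
    by rewrite -ltr_pdivrMr ?invr_gt0// invrK mulrC.
have [a aP] := choice ex.
have [n|n|n|f [l [fn al]]] := @embedding_subseq a 1.
- by case: (aP n).
- by case: (aP n) => _ ->.
- case: (aP n) => _ _ h; apply: le_trans (ltW h) _.
  by rewrite /harmonic invf_le1 ?ltr0n// ler1n.
have l1 : hnorm l = 1.
  apply: (cvg_unique _ (cvg_hnorm al)); first exact: Rhausdorff.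
  rewrite (_ : (fun n => _) = cst 1); first exact: cvg_cst.
  by apply/funext => n /=; case: (aP (f n)).
have Ca0 : C (a (f n)) @[n --> \oo] --> (0 : F).
  apply: (cvg_hnorm_le (u := harmonic \o f)).
    by apply: nearW => n /=; rewrite subr0 ltW//; case: (aP (f n)).
  exact: (cvg_reindex fn (@cvg_harmonic R)).
have aV n : V (a (f n)) by case: (aP (f n)).
have [dl l0] := closed_graph (fun n => (aV n).1) al Ca0.
have ol : orthocompl (op_ker C) l by apply: (cvg_dot0 al) => n; case: (aV n).
have : ip l l = 0 by apply: (ortho_ip ol).
by rewrite ipxx l1 expr1n => /eqP; rewrite oner_eq0.
Qed.

(** Compactness in both components. For [C d_n] it comes from
    [|C x|^2 = <x, C^* C x>] with [x] a difference of terms of [d_n]: if [d_n] is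
    Cauchy and [C^* C d_n] is bounded, then [C d_n] is Cauchy. *)
Lemma compact_pair (a d : nat -> E) (M : R) :
  (forall n, [/\ V (a n), hnorm (a n) <= M & hnorm (C (a n)) <= M]) ->
  (forall n, [/\ V (d n), hnorm (d n) <= M & hnorm (C (d n)) <= M]) ->
  (forall n, opdom Cs (C (d n)) /\ hnorm (Cs (C (d n))) <= M) ->
  exists (f : nat -> nat) (l : E) (m : F), [/\ forall n, (n <= f n)%N,
    a (f n) @[n --> \oo] --> l & C (d (f n)) @[n --> \oo] --> m].
Proof.
move=> aP dP CdP.
have [n|n|n|f [l [fn al]]] := @embedding_subseq a M; try by case: (aP n).
have [n|n|n|g [k [gn dk]]] := @embedding_subseq (d \o f) M; try by case: (dP (f n)).
have M0 : 0 <= M by case: (aP 0%N) => _ h _; apply: le_trans h; exact: hnorm_ge0.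
have [|m Cm] := cauchy_seq_cvg (s := fun n => C (d (f (g n)))).
  move=> e e0; pose e' := e ^+ 2 / (4 * M + 1) / 2.
  have M1 : 0 < 4 * M + 1 by lra.
  have e'0 : 0 < e' by rewrite !divr_gt0 ?exprn_gt0.
  have [N _ hN] := (cvg_hnormP _ _).1 dk _ e'0.
  exists N => i j Ni Nj.
  rewrite -(@ltr_pXn2r _ 2) ?nnegrE ?hnorm_ge0 ?(ltW e0)//.
  set x := d (f (g i)); set y := d (f (g j)).
  have [[dx _] _ _] := dP (f (g i)); have [[dy _] _ _] := dP (f (g j)).
  have [ex bx] := CdP (f (g i)); have [ey by_] := CdP (f (g j)).
  rewrite -/x in dx ex bx; rewrite -/y in dy ey by_.
  have [sCs lCs] := adjoint_linear.
  have dd : opdom Cs (C x - C y) by exact: subspaceB.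
  rewrite -ipxx -{1}CB// adjoint_ip//; last exact: subspaceB.
  have -> : Cs (C x - C y) = Cs (C x) - Cs (C y).
    by rewrite addrC -scaleN1r lCs// scaleN1r addrC.
  have h1 := hnorm_triangle 0 (Cs (C x)) (Cs (C y)).
  rewrite subr0 sub0r hnormN in h1.
  have h2 : hnorm (x - y) < 2 * e'.
    have := hnorm_triangle k x y; rewrite (hnormBC k).
    have := hN _ Ni; have := hN _ Nj => /= h3 h4 h5; lra.
  apply: le_lt_trans (ip_le _ _) _.
  have h3 : 2 * e' * (4 * M + 1) = e ^+ 2 by rewrite /e'; field; lra.
  have h4 := hnorm_ge0 (x - y); have h5 := hnorm_ge0 (Cs (C x) - Cs (C y)).
  rewrite -h3; apply: le_lt_trans (ler_wpM2r h5 (ltW h2)) _.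
  by rewrite ltr_pM2l; lra.
exists (f \o g), l, m; split=> //=.
  by move=> n; apply: leq_trans (gn n) (fn _).
exact: (cvg_reindex gn al).
Qed.

End ClosedOperator.

(** * The damping operator *)

Section Damping.
Variables (R : realType) (E : hilbertType R).

(** Cauchy-Schwarz for the nonnegative form [<g x, y>], applied to [x] and [g x]. *)
Lemma symmetric_coercive (V : set E) (g : E -> E) : subspace_set V -> closed V ->
  bounded_on V g -> (forall x, V x -> g x = adjoint_on V g x) -> ge_on V g 0 ->
  exists2 M : R, 0 <= M & forall x, V x -> hnorm (g x) ^+ 2 <= M * ip (g x) x.
Proof.
move=> sV cV bg gsym gpos; have adj := adjoint_on_dot sV cV bg.
case: bg => gV glin [M gM]; exists `|M| => // x Vx.
have pos y : V y -> 0 <= ip (g y) y.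
  by move=> Vy; have := gpos _ Vy; rewrite rmorph0 mul0r lecE => /andP[].
have [g0|gN] := eqVneq (hnorm (g x)) 0.
  by rewrite g0 expr0n mulr_ge0// pos.
have gp : 0 < hnorm (g x) ^+ 2 by rewrite exprn_gt0// lt_neqAle eq_sym gN hnorm_ge0.
have Vg := gV _ Vx.
have CS : (hnorm (g x) ^+ 2) ^+ 2 <= ip (g x) x * ip (g (g x)) (g x).
  apply: quad_ge0; [exact: pos|exact: pos|move=> t].
  have Vt : V (t%:C *: g x + x) by case: sV => _; exact.
  have := pos _ Vt; rewrite glin// !ipE ipxx.
  have -> : ip (g (g x)) x = hnorm (g x) ^+ 2.
    by rewrite -ipxx /ip; have [_ ->//] := adj _ Vx; rewrite -gsym.
  move=> h; lra.
have up : ip (g (g x)) (g x) <= `|M| * hnorm (g x) ^+ 2.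
  apply: le_trans (ip_le _ _) _; rewrite expr2 mulrA ler_wpM2r ?hnorm_ge0//.
  by apply: le_trans (gM _ Vg) _; rewrite ler_wpM2r ?hnorm_ge0// ler_norm.
rewrite -(ler_pM2r gp) -expr2; apply: le_trans CS _.
by rewrite mulrAC mulrC ler_wpM2r// pos.
Qed.

Lemma re_on_ip (V : set E) (g : E -> E) (c : R) : subspace_set V -> closed V ->
  bounded_on V g -> ge_on V (re_on V g) c ->
  forall x, V x -> c * hnorm x ^+ 2 <= ip (g x) x.
Proof.
move=> sV cV bg gc x Vx; have [_ adj] := adjoint_on_dot sV cV bg Vx.
have := gc _ Vx; rewrite lecE => /andP[_].
have -> : complex.Re (c%:C * '[x, x]) = c * hnorm x ^+ 2.
  by rewrite -dotZl -/(ip _ _) ipZl ipxx.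
have -> : complex.Re '[re_on V g x, x] = 2^-1 * (ip (g x) x + ip (adjoint_on V g x) x).
  rewrite -/(ip _ _) /re_on; have -> : 2^-1 = (2^-1)%:C :> R[i].
    by rewrite fmorphV rmorph_nat.
  by rewrite ipZl ipDl.
have -> : ip (adjoint_on V g x) x = ip (g x) x by rewrite ipC /ip adj.
by move=> h; lra.
Qed.

(** On the coercive summand [|gamma a|^2] is bounded by a multiple of [|a|^2], on the
    selfadjoint one by [symmetric_coercive], and the two contributions are
    orthogonal. The estimate says that a state without dissipation is not damped
    at all, and that damping forces tend to zero whenever the dissipation does. *)
Lemma sectorial (gamma : E -> E) :
  (exists (U : set E) (c : R) (gU gUo : E -> E),
       [/\ subspace_set U /\ closed U,
           0 < c,
           bounded_on U gU /\ bounded_on (orthocompl U) gUo,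
           ge_on U (re_on U gU) c
         & [/\ forall x, orthocompl U x ->
                 gUo x = adjoint_on (orthocompl U) gUo x,
               ge_on (orthocompl U) gUo 0
             & forall x y, U x -> orthocompl U y ->
                 gamma (x + y) = gU x + gUo y]]) ->
  exists2 K : R, 0 < K & forall x, hnorm (gamma x) ^+ 2 <= K * ip (gamma x) x.
Proof.
move=> [U [c [gU [gUo [[sU cU] c0 [bU bUo] gUc [gsym gpos gE]]]]]].
have [M' M'0 hM'] :=
  symmetric_coercive (subspace_ortho U) (@closed_ortho _ _ U) bUo gsym gpos.
have hc := re_on_ip sU cU bU gUc.
have gUoV : forall x, orthocompl U x -> orthocompl U (gUo x) by case: bUo.
have pos y : orthocompl U y -> 0 <= ip (gUo y) y.
  by move=> Vy; have := gpos _ Vy; rewrite rmorph0 mul0r lecE => /andP[].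
case: bU => gUV _ [M gM].
have P0 : 0 <= M ^+ 2 / c by rewrite divr_ge0 ?sqr_ge0// ltW.
exists (M ^+ 2 / c + M' + 1); first lra.
move=> x; have [a [b [Ua Ub ->]]] :
    exists a b, [/\ U a, orthocompl U b & x = a + b].
  have [a Ua Ub] := projection x sU cU; by exists a, (x - a); split=> //; rewrite addrC subrK.
rewrite gE// hnorm_sqrD !ipE.
rewrite (ortho_ipr (gUoV _ Ub) (gUV _ Ua)) (ortho_ipr Ub (gUV _ Ua)) (ortho_ip (gUoV _ Ub) Ua).
have h1 := hM' _ Ub; have h2 := pos _ Ub; have h3 := hc _ Ua.
have h4 : hnorm (gU a) ^+ 2 <= M ^+ 2 / c * ip (gU a) a.
  have h5 : hnorm (gU a) ^+ 2 <= M ^+ 2 * hnorm a ^+ 2.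
    by rewrite -exprMn ler_pXn2r ?nnegrE ?hnorm_ge0 ?gM// (le_trans _ (gM _ Ua))// hnorm_ge0.
  apply: le_trans h5 _; rewrite -mulrA ler_wpM2l ?sqr_ge0//.
  by rewrite mulrC ler_pdivlMr// mulrC.
have h6 : 0 <= ip (gU a) a by apply: le_trans h3; rewrite mulr_ge0 ?sqr_ge0// ltW.
have h7 := mulr_ge0 P0 h2; have h8 := mulr_ge0 M'0 h6; nra.
Qed.

End Damping.

(** * The block operator *)

Section Block.
Variables (R : realType) (H0 H1 : hilbertType R) (C : operator H0 H1).
Variable gamma : H0 -> H0.
Hypothesis C_linear : linear_operator C.
Hypothesis C_dense : dense (opdom C).
Hypothesis C_closed : closed (op_graph C).
Hypothesis ranC_closed : closed (op_ran C).
Hypothesis C_compact :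
  compact_embedding (opdom C `&` orthocompl (op_ker C)) (graph_norm C).
Hypothesis gamma_lin : lin_map gamma.
Variable Mg : R.
Hypothesis gamma_bound : forall x, hnorm (gamma x) <= Mg * hnorm x.
Variable K : R.
Hypothesis K_gt0 : 0 < K.
Hypothesis gamma_sect : forall x, hnorm (gamma x) ^+ 2 <= K * ip (gamma x) x.

Local Notation A := (block_operator gamma C).
Local Notation Cs := (op_adjoint C).
Local Notation V := (opdom C `&` orthocompl (op_ker C)).

Let sC : subspace_set (opdom C) := C_linear.1.
Let Cs_linear := adjoint_linear C_dense.
Let sCs : subspace_set (opdom Cs) := Cs_linear.1.

Lemma block_fst u : (A u).1 = Cs u.2 - gamma u.1.
Proof. by rewrite /= opprK addrC. Qed.

Lemma block_snd u : (A u).2 = - C u.1.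
Proof. by rewrite /= oppr0 add0r. Qed.

Lemma block_eq u a b : Cs u.2 - gamma u.1 = a -> - C u.1 = b -> A u = (a, b).
Proof. by move=> <- <-; rewrite -block_fst -block_snd; case: (A u). Qed.

Lemma gamma_ge0 x : 0 <= ip (gamma x) x.
Proof. by rewrite -(pmulr_rge0 _ K_gt0); apply: le_trans (gamma_sect x); exact: sqr_ge0. Qed.

Lemma block_ip u : opdom A u -> ip (A u) u = - ip (gamma u.1) u.1.
Proof.
move=> [d1 d2]; rewrite ip_pair block_fst block_snd !ipE.
by rewrite (adjoint_ip d2 d1) ipC; ring.
Qed.

Lemma block_linear : linear_operator A.
Proof.
split.
  split; first by split; exact: subspace0.
  by move=> a x y [dx1 dx2] [dy1 dy2]; split; [exact: sC.2|exact: sCs.2].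
move=> a x y [dx1 dx2] [dy1 dy2].
have e1 : C (a *: x + y).1 = a *: C x.1 + C y.1 by exact: C_linear.2.
have e2 : Cs (a *: x + y).2 = a *: Cs x.2 + Cs y.2 by exact: Cs_linear.2.
have e3 : gamma (a *: x + y).1 = a *: gamma x.1 + gamma y.1 by exact: gamma_lin.
rewrite [RHS]surjective_pairing; apply: block_eq.
  by rewrite e2 e3 /= !opprK scalerDr scalerN opprD [LHS]addrACA;
     congr (_ + _); rewrite addrC.
by rewrite e1 /= !oppr0 !add0r opprD scalerN.
Qed.

Lemma gamma_cvg (s : nat -> H0) x : s @ \oo --> x ->
  gamma (s n) @[n --> \oo] --> gamma x.
Proof.
move=> /cvg_hnorm0P sx; apply: (cvg_hnorm_le (u := fun n => Mg * hnorm (s n - x))).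
  by apply: nearW => n; rewrite -lin_mapB.
by rewrite -(mulr0 Mg); exact: cvgMr.
Qed.

(** A pair [(f, g)] orthogonal to the range of [1 - hA] satisfies [<g, v> = h <f, C^* v>]
    for all [v], so that [h f] is in the domain of the double adjoint, that is, of
    [C], and [g = C (h f)]. Testing with [(f, 0)] then gives
    [|f|^2 + h Re <gamma f, f> + |h C f|^2 = 0]. *)
Lemma block_mdissipative : mdissipative A.
Proof.
apply: mdissipative_closed; first exact: block_linear.
- by move=> x dx; rewrite block_ip// oppr_le0 gamma_ge0.
- move=> s x y sd sx sy.
  have sx1 := cvg_fst sx; have sx2 := cvg_snd sx.
  have sy1 := cvg_fst sy; have sy2 := cvg_snd sy.
  have [dx1 ex1] : opdom C x.1 /\ C x.1 = - y.2.
    apply: (closed_graph C_closed _ sx1) => [n|]; first by case: (sd n).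
    rewrite (_ : (fun n => _) = (fun n => - (A (s n)).2)); first exact: cvgN.
    by apply/funext => n; rewrite block_snd opprK.
  have [dx2 ex2] : opdom Cs x.2 /\ Cs x.2 = y.1 + gamma x.1.
    apply: (adjoint_closed C_linear C_dense _ sx2) => [n|]; first by case: (sd n).
    rewrite (_ : (fun n => _) = (fun n => (A (s n)).1 + gamma (s n).1)).
      by apply: cvgD => //; exact: gamma_cvg.
    by apply/funext => n; rewrite block_fst subrK.
  split=> //; rewrite [y in RHS]surjective_pairing; apply: block_eq.
    by rewrite ex2 addrK.
  by rewrite ex1 opprK.
- move=> h [f g] h0 orth.
  have orth2 (a : H0) (b : H1) : opdom C a -> opdom Cs b ->
      ip f (a - h%:C *: (Cs b - gamma a)) + ip g (b + h%:C *: C a) = 0.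
    move=> da db; rewrite -[C a]opprK scalerN.
    have := orth ((a, b) : hprod H0 H1) (conj da db).
    by rewrite ip_pair -(block_fst (a, b)) -(block_snd (a, b)).
  have [d1 e1] : opdom C (h%:C *: f) /\ C (h%:C *: f) = g.
    apply: (double_adjoint C_linear C_dense C_closed) => v dv.
    have hv (w : H1) : opdom Cs w -> ip g w = h * ip f (Cs w).
      move=> dw; have := orth2 0 w (subspace0 sC) dw.
      rewrite (lin_map0 gamma_lin) (linop0 C_linear) scaler0 addr0 subr0 sub0r !ipE => e.
      by lra.
    have dv' : opdom Cs ('i *: v) by exact: subspaceZ.
    apply: dot_eq; first by rewrite hv// -ipZl.
    rewrite hv//; rewrite (linopZ Cs_linear)//.
    by rewrite -ipZl -Im_dot.
  have df : opdom C f.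
    rewrite -[f]scale1r -(rmorph1 (real_complex R)) -(mulVf (lt0r_neq0 h0)) rmorphM -scalerA.
    exact: subspaceZ.
  have := orth2 f 0 df (subspace0 sCs).
  rewrite (linop0 Cs_linear) -e1 (linopZ C_linear)// !add0r !ipE !ipxx (ipC f) => e.
  have p1 := gamma_ge0 f; have p2 := sqr_ge0 (hnorm (C f)); have p3 := sqr_ge0 (hnorm f).
  have f0 : hnorm f ^+ 2 = 0 by nra.
  have f0' : f = 0 by apply: ip_eq0; rewrite ipxx.
  by rewrite f0' (linop0 C_linear) scaler0.
Qed.

Let mA := block_mdissipative.

(** The kernel of [C] is excluded because the embedding into [H0] need not be compact
    on it; the motion in this kernel is controlled by other means in
    [orbit_subseq]. *)
Definition lossless : set (hprod H0 H1) :=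
  [set u | orthocompl (op_ker C) u.1 /\ gamma u.1 = 0].

Lemma lossless_subspace : subspace_set lossless.
Proof.
split; first by split; [exact: (subspace0 (subspace_ortho _))|exact: lin_map0].
move=> a x y [ox gx] [oy gy]; split; first exact: (subspace_ortho _).2.
by rewrite /= gamma_lin gx gy scaler0 addr0.
Qed.

Lemma lossless_closed : closed lossless.
Proof.
move=> u /closure_seq[s sQ su]; have su1 := cvg_fst su; split.
  by apply: (cvg_dot0 su1) => n; case: (sQ n).
apply: (cvg_seq_unique (gamma_cvg su1)).
rewrite (_ : (fun n => _) = cst 0); first exact: cvg_cst.
by apply/funext => n; case: (sQ n).
Qed.

Lemma lossless_conserv r : opdom A r -> lossless r -> ip (A r) r = 0.
Proof. by move=> dr [_ g0]; rewrite block_ip// g0 ip0l oppr0. Qed.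

(** On these states the damping vanishes, and the second component is orthogonal to
    the kernel of [C^*], hence lies in the range of [C] with a preimage bounded by
    [bounded_below]. *)
Lemma lossless_compact (p : nat -> hprod H0 H1) : (forall n, hnorm (p n) <= 1) ->
  (forall n, orthocompl (op_ker A) (p n)) ->
  (forall n, lossless (resolvent A 1 (p n))) ->
  exists (f : nat -> nat) (l : hprod H0 H1), (forall n, (n <= f n)%N) /\
    resolvent A 1 (p (f n)) @[n --> \oo] --> l.
Proof.
move=> p1 pX Qp; pose r n := resolvent A 1 (p n).
have dr n : opdom A (r n) by exact: resolvent_dom.
have r1 n : hnorm (r n) <= 1.
  by apply: le_trans (p1 n); exact: (resolvent_contractive mA ltr01).
have Ar n : hnorm (A (r n)) <= 2.
  have -> : A (r n) = r n - p n.
    by rewrite -[X in _ - X](resolvent1_eq mA) opprB addrC subrK.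
  have := hnormD (r n) (- p n); rewrite hnormN => h; have := r1 n; have := p1 n; lra.
have [K1 K10 hK1] := bounded_below C_linear C_closed C_compact.
have /choice[d dP] (n : nat) : exists d, V d /\ C d = (r n).2.
  have [c dc ec] : op_ran C (r n).2.
    apply: (ortho_ortho (subspace_ran C_linear) ranC_closed).
    rewrite (ortho_ran C_dense) => y [dy y0].
    have kA : op_ker A ((0, y) : hprod H0 H1).
      split; first by split=> //; exact: subspace0.
      by apply: block_eq; rewrite /= ?y0 ?(lin_map0 gamma_lin) ?(linop0 C_linear) ?subr0 ?oppr0.
    have := resolvent_ker_ortho mA (pX n) kA; rewrite hprod_dotE /= linear0 add0r; exact.
  have [w kw [ow _ dw]] := ker_decomp C_linear C_closed c.
  by have [dcw ecw] := dw dc; exists (c - w); rewrite ecw.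
have [||| f [l [m [fn al dm]]]] := @compact_pair _ _ _ C C_linear C_dense C_compact
   (fun n => (r n).1) d (2 + K1).
- move=> n; have [oc _] := Qp n; have [dc _] := dr n; split=> //.
    by apply: le_trans (hnorm_fst _) _; have := r1 n; lra.
  by rewrite -hnormN -block_snd; apply: le_trans (hnorm_snd _) _; have := Ar n; lra.
- move=> n; have [Vd ed] := dP n; have h2 : hnorm (r n).2 <= 1.
    by apply: le_trans (hnorm_snd _) _.
  split=> //; last by rewrite ed; lra.
  apply: le_trans (hK1 _ Vd) _; rewrite ed.
  by apply: le_trans (ler_wpM2l K10 h2) _; lra.
- move=> n; have [_ ed] := dP n; have [_ d2] := dr n; rewrite ed; split=> //.
  have -> : Cs (r n).2 = (A (r n)).1.
    by rewrite block_fst; have [_ ->] := Qp n; rewrite subr0.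
  by apply: le_trans (hnorm_fst _) _; have := Ar n; lra.
exists f, (l, m); split=> //; apply: cvg_hpair => //=.
rewrite (_ : (fun n => _) = (fun n => C (d (f n))))//.
by apply/funext => n; case: (dP (f n)).
Qed.

Lemma gamma_orbit x : opdom_pow A 2 x ->
  gamma (semigroup A n%:R x).1 @[n --> \oo] --> (0 : H0).
Proof.
move=> dx; have := dissipation_cvg0 mA dx => h0.
have h1 : K * - ip (A (semigroup A n%:R x)) (semigroup A n%:R x) @[n --> \oo] --> (0 : R).
  by rewrite -(mulr0 K) -[X in K * X]oppr0; apply: cvgMr; exact: cvgN.
apply/cvg_hnormP => e e0; have e2 : 0 < e ^+ 2 by rewrite exprn_gt0.
move/cvgr0Pnorm_lt/(_ _ e2): h1; apply: filterS => n hn.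
have dx1 : opdom A x by case: dx.
have [dT _] := semigroup_op mA (ler0n R n) dx1.
rewrite subr0 -(@ltr_pXn2r _ 2) ?nnegrE ?hnorm_ge0 ?(ltW e0)//.
apply: le_lt_trans (gamma_sect _) _; apply: le_lt_trans hn.
by rewrite (block_ip dT) opprK ler_norm.
Qed.

(** The orbit of [A x] is [A] applied to the orbit of [x]. With [(u, v)] the orbit of
    [x], the first component is [C^* v - gamma u], whose part in the kernel of [C]
    equals that of [- gamma u] and tends to zero by [gamma_orbit]; the second is
    [- C u]. What remains of the first component, and [u] itself modulo the kernel,
    are bounded in the graph norm, so that [compact_pair] applies. Finally
    [gamma_orbit] for [A x] shows that the limit is undamped. *)
Lemma orbit_subseq x (f : nat -> nat) : opdom_pow A 3 x -> (forall n, (n <= f n)%N) ->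
  exists (g : nat -> nat) (l : hprod H0 H1), [/\ forall n, (n <= g n)%N, lossless l &
    semigroup A (f (g n))%:R (A x) @[n --> \oo] --> l].
Proof.
move=> dx3 fn; have [dx [dAx [dAAx _]]] := dx3.
pose X n := semigroup A (f n)%:R x; pose Z n := semigroup A (f n)%:R (A x).
have t0 n : 0 <= (f n)%:R :> R by [].
have XP n : opdom A (X n) /\ A (X n) = Z n by exact: semigroup_op.
have ZP n : opdom A (Z n) /\ A (Z n) = semigroup A (f n)%:R (A (A x)) by exact: semigroup_op.
have gX : gamma (X n).1 @[n --> \oo] --> (0 : H0).
  by apply: (cvg_reindex fn (gamma_orbit _)); exact: opdom_powS.
have gZ : gamma (Z n).1 @[n --> \oo] --> (0 : H0).
  by apply: (cvg_reindex fn (gamma_orbit _)).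
have Xb n : hnorm (X n) <= hnorm x by exact: semigroup_contractive.
have Zb n : hnorm (Z n) <= hnorm (A x) by exact: semigroup_contractive.
have AZb n : hnorm (A (Z n)) <= hnorm (A (A x)).
  by have [_ ->] := ZP n; exact: semigroup_contractive.
have gb y (c : R) : hnorm y <= c -> hnorm (gamma y) <= `|Mg| * c.
  move=> yc; apply: le_trans (gamma_bound _) _.
  apply: le_trans (ler_wpM2r (hnorm_ge0 _) (ler_norm Mg)) _.
  by rewrite ler_wpM2l.
pose M := hnorm x + hnorm (A x) + hnorm (A (A x)) + `|Mg| * hnorm x + `|Mg| * hnorm (A x).
have b0 := hnorm_ge0 x; have b1 := hnorm_ge0 (A x); have b2 := hnorm_ge0 (A (A x)).
have b3 : 0 <= `|Mg| * hnorm x by rewrite mulr_ge0.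
have b4 : 0 <= `|Mg| * hnorm (A x) by rewrite mulr_ge0.
have Z1 n : (Z n).1 = Cs (X n).2 - gamma (X n).1 by have [_ <-] := XP n; exact: block_fst.
have Z2 n : (Z n).2 = - C (X n).1 by have [_ <-] := XP n; exact: block_snd.
(* w n is the part of (Z n).1 in the kernel of C, to which the range of C^* is
   orthogonal. *)
have /choice[w wP] (n : nat) : exists w, [/\ V ((Z n).1 - w),
    hnorm ((Z n).1 - w) <= hnorm (Z n).1, C ((Z n).1 - w) = C (Z n).1 &
    hnorm w <= hnorm (gamma (X n).1)].
  have [w [dw w0] [ow wb dwC]] := ker_decomp C_linear C_closed (Z n).1.
  have [[dZ _] _] := ZP n; have [dZw eZw] := dwC dZ.
  exists w; split=> //.
  have [hw|hw] := eqVneq (hnorm w) 0; first by rewrite hw hnorm_ge0.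
  have hw0 : 0 < hnorm w by rewrite lt_neqAle eq_sym hw hnorm_ge0.
  rewrite -(ler_pM2r hw0) -expr2 -ipxx.
  have kw : op_ker C w by [].
  have : ip ((Z n).1 - w) w = 0 by exact: ortho_ip ow kw.
  have [[_ d2] _] := XP n.
  rewrite Z1 !ipE -(ipC w) -(adjoint_ip d2 dw) w0 ip0l sub0r => e.
  have -> : ip w w = ip (- gamma (X n).1) w by rewrite ipNl; lra.
  by apply: le_trans (ip_le _ _) _; rewrite hnormN.
have /choice[d dP] (n : nat) : exists d, [/\ V d, hnorm d <= hnorm (X n).1 & C d = C (X n).1].
  have [v kv [ov vb dv]] := ker_decomp C_linear C_closed (X n).1.
  have [[dX _] _] := XP n; have [dXv eXv] := dv dX.
  by exists ((X n).1 - v).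
have [||| g [l [m [gn al dm]]]] := @compact_pair _ _ _ C C_linear C_dense C_compact
   (fun n => (Z n).1 - w n) d M.
- move=> n; have [Vn wb ew _] := wP n; split=> //.
    by apply: le_trans wb _; apply: le_trans (hnorm_fst _) _; have := Zb n; rewrite /M; lra.
  rewrite ew -hnormN -block_snd; apply: le_trans (hnorm_snd _) _.
  by have := AZb n; rewrite /M; lra.
- move=> n; have [Vn db ed] := dP n; split=> //.
    by apply: le_trans db _; apply: le_trans (hnorm_fst _) _; have := Xb n; rewrite /M; lra.
  rewrite ed -hnormN -Z2; apply: le_trans (hnorm_snd _) _.
  by have := Zb n; rewrite /M; lra.
- move=> n; have [Vn db ed] := dP n; have [[_ d2] _] := ZP n.
  have eC : C (d n) = (-1) *: (Z n).2 by rewrite ed Z2 scaleN1r opprK.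
  rewrite eC; split; first exact: subspaceZ.
  rewrite (linopZ Cs_linear)// scaleN1r hnormN.
  have -> : Cs (Z n).2 = (A (Z n)).1 + gamma (Z n).1 by rewrite block_fst subrK.
  apply: le_trans (hnormD _ _) _.
  have h1 := hnorm_fst (A (Z n)); have h2 := AZb n.
  have h3 := gb _ _ (le_trans (hnorm_fst (Z n)) (Zb n)).
  rewrite /M; lra.
have w0 : w (g n) @[n --> \oo] --> (0 : H0).
  apply: (cvg_reindex gn (s := w)); apply: (cvg_hnorm_le (u := fun n => hnorm (gamma (X n).1))).
    by apply: nearW => n; rewrite subr0; case: (wP n).
  by move/cvg_hnorm0P: gX; under eq_fun do rewrite subr0.
have Zl1 : (Z (g n)).1 @[n --> \oo] --> l.
  rewrite -(addr0 l) (_ : (fun n => _) = (fun n => ((Z (g n)).1 - w (g n)) + w (g n))).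
    exact: cvgD.
  by apply/funext => n; rewrite subrK.
have Zl2 : (Z (g n)).2 @[n --> \oo] --> - m.
  rewrite (_ : (fun n => _) = (fun n => - C (d (g n)))); first exact: cvgN.
  by apply/funext => n; rewrite Z2; have [_ _ ->] := dP (g n).
exists g, (l, - m); split=> //; last exact: cvg_hpair.
split=> /=.
  by apply: (cvg_dot0 al) => n; have [[]] := wP (g n).
apply: (cvg_seq_unique (gamma_cvg Zl1)); exact: (cvg_reindex gn gZ).
Qed.

End Block.

Theorem theorem4p5 (R : realType) (H0 H1 : hilbertType R)
    (C : operator H0 H1) (gamma : H0 -> H0)
    (C_linear : linear_operator C)
    (C_dense : dense (opdom C))
    (C_closed : closed (op_graph C))
    (ranC_closed : closed (op_ran C))
    (C_compact :
       compact_embedding (opdom C `&` orthocompl (op_ker C)) (graph_norm C))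
    (gamma_bounded : bounded_on setT gamma)
    (gamma_ge0 : ge_on setT (re_on setT gamma) 0)
    (gamma_split : exists (U : set H0) (c : R) (gU gUo : H0 -> H0),
       [/\ subspace_set U /\ closed U,
           0 < c,
           bounded_on U gU /\ bounded_on (orthocompl U) gUo,
           ge_on U (re_on U gU) c
         & [/\ forall x, orthocompl U x ->
                 gUo x = adjoint_on (orthocompl U) gUo x,
               ge_on (orthocompl U) gUo 0
             & forall x y, U x -> orthocompl U y ->
                 gamma (x + y) = gU x + gUo y]])
    (A := block_operator gamma C)
    (iA_inj : forall lambda : R, lambda != 0 ->
       set_inj (opdom A) (fun u => (lambda%:C * 'i) *: u - A u))
    (iAstar_inj : forall lambda : R, lambda != 0 ->
       set_inj (opdom (op_adjoint A))
         (fun u => (lambda%:C * 'i) *: u - op_adjoint A u)) :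
  exists T : R -> hprod H0 H1 -> hprod H0 H1,
    generates (closure (op_ran A)) (restrict_ker_orthocompl A) T /\
    strongly_stable (closure (op_ran A)) T.
Proof.
have [_ glin [Mg gM]] := gamma_bounded.
have {}glin : lin_map gamma by move=> a x y; exact: glin.
have {}gM x : hnorm (gamma x) <= Mg * hnorm x by exact: gM.
have [K K0 gK] := sectorial gamma_split.
have mA : mdissipative A.
  exact: (block_mdissipative C_linear C_dense C_closed glin gM K0 gK).
have A0 : A 0 = 0 by apply: linop0; case: mA.
have d0 : opdom A 0 by case: mA => -[/subspace0].
have no_eigen (l : R) x : l != 0 -> opdom A x -> A x = (l%:C * 'i) *: x -> x = 0.
  move=> l0 dx Ax; apply: (iA_inj l l0); rewrite ?inE//.
  by rewrite Ax subrr A0 scaler0 subr0.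
exists (semigroup A); rewrite (closure_ran mA); split; last first.
  move=> x Xx; apply: (lasalle_stability mA (lossless_subspace C glin)
    (lossless_closed glin gM) _ _ no_eigen _ Xx).
  - exact: lossless_conserv.
  - exact: (lossless_compact C_linear C_dense C_closed ranC_closed C_compact glin gM K0 gK).
  - exact: (orbit_subseq C_linear C_dense C_closed C_compact glin gM K0 gK).
split.
  split.
  - move=> t t0; split.
    + by move=> x; exact: semigroup_ker_ortho.
    + by move=> a x y _ _; exact: semigroup_lin.
    + by exists 1 => x _; rewrite mul1r; exact: semigroup_contractive.
  - by move=> x _; exact: semigroup0.
  - by move=> s t x s0 t0 _; exact: semigroupD.
  - by move=> x _; exact: semigroup_cvg0.
apply/seteqP; split=> -[x y].
  move=> [[dx ox] e]; change (A x = y) in e; split=> //.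
  by change (((t^-1)%:C *: (semigroup A t x - x)) @[t --> 0^'+] --> y); rewrite -e; exact: semigroup_derive.
move=> [ox /(semigroup_derive_inv mA)[dx e]]; split; first by split.
exact: e.
Qed.
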